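(* Apart from $K_5$, the A$^*$SP graphs are $4$-vertex-colorable in polynomial time.
   Context: Graphs are finite, simple and undirected. $P_k$ is the path on $k$ vertices and $C_4$ is the cycle of length $4$. For a graph $H$, the skeleton of $H$ is its subgraph induced by the edges of $H$ both of whose ends have degree at least $3$ in $H$. $K_4\langle S\rangle$ denotes a subdivision of $K_4$ whose skeleton is isomorphic to $S$. A graph is A$^*$SP if it contains no $K_4\langle P_3\rangle$, no $K_4\langle P_4\rangle$ and no $K_4\langle C_4\rangle$ as a subgraph. $4$-vertex-colorable means having a proper vertex coloring with at most $4$ colors.
   Formalization: ''Apart from K_5'' is read as excluding every A*SP graph that contains K_5 as a subgraph, not only K_5 itself; e.g. K_5 plus an isolated vertex is A*SP but not 4-colorable, so the literal claim fails. *)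

(* Defs.v *)
From mathcomp Require Import all_boot.
Set Implicit Arguments.
Unset Strict Implicit.
Unset Printing Implicit Defensive.

Record sgraph := SGraph {
  vertex :> finType;
  sedge : rel vertex;
  sedge_sym : symmetric sedge;
  sedge_irr : irreflexive sedge
}.

Notation "x -- y" := (sedge x y) (at level 30, no associativity).

Definition degree (G : sgraph) (x : G) : nat := #|[set y | x -- y]|.

Definition isomorphic (G H : sgraph) : Prop :=
  exists2 f : G -> H, bijective f & forall x y, (f x -- f y) = (x -- y).

(* Not necessarily induced. *)
Definition subgraph (H G : sgraph) : Prop :=
  exists2 f : H -> G, injective f & forall x y, x -- y -> f x -- f y.

Definition complete_rel n : rel 'I_n := fun i j => i != j.

Lemma complete_sym n : symmetric (@complete_rel n).
Proof. by move=> i j; rewrite /complete_rel eq_sym. Qed.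

Lemma complete_irr n : irreflexive (@complete_rel n).
Proof. by move=> i; rewrite /complete_rel eqxx. Qed.

Definition complete_graph n : sgraph :=
  SGraph (@complete_sym n) (@complete_irr n).

Definition path_rel n : rel 'I_n :=
  fun i j => (i.+1 == j :> nat) || (j.+1 == i :> nat).

Lemma path_sym n : symmetric (@path_rel n).
Proof. by move=> i j; rewrite /path_rel orbC. Qed.

Lemma path_irr n : irreflexive (@path_rel n).
Proof. by move=> i; rewrite /path_rel orbb gtn_eqF. Qed.

(* The index is the number of vertices. *)
Definition path_graph n : sgraph := SGraph (@path_sym n) (@path_irr n).

Definition cycle_rel n : rel 'I_n :=
  fun i j => (i != j) && ((i.+1 %% n == j) || (j.+1 %% n == i)).

Lemma cycle_sym n : symmetric (@cycle_rel n).
Proof. by move=> i j; rewrite /cycle_rel eq_sym orbC. Qed.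

Lemma cycle_irr n : irreflexive (@cycle_rel n).
Proof. by move=> i; rewrite /cycle_rel eqxx. Qed.

Definition cycle_graph n : sgraph := SGraph (@cycle_sym n) (@cycle_irr n).

Section Skeleton.
Variable H : sgraph.

Definition skeleton_rel : rel H :=
  fun x y => [&& x -- y, 3 <= degree x & 3 <= degree y].

Definition skeleton_vertex : finType := {x : H | [exists y, skeleton_rel x y]}.

Definition skeleton_edge : rel skeleton_vertex := relpre val skeleton_rel.

Lemma skeleton_sym : symmetric skeleton_edge.
Proof.
by move=> x y; rewrite /skeleton_edge /= /skeleton_rel sedge_sym [X in _ && X]andbC.
Qed.

Lemma skeleton_irr : irreflexive skeleton_edge.
Proof. by move=> x; rewrite /skeleton_edge /= /skeleton_rel sedge_irr. Qed.

Definition skeleton : sgraph := SGraph skeleton_sym skeleton_irr.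

End Skeleton.

Definition consecutive (T : eqType) (s : seq T) (u v : T) : bool :=
  (u, v) \in zip s (behead s).

(* H arises from K by replacing the edges of K with internally disjoint paths:
   b gives the branch vertices and, for every edge x -- y of K, the sequence
   p x y lists the subdividing vertices met when going from b x to b y.
   Every edge of K is listed in both directions. *)
Definition subdivision (K H : sgraph) : Prop :=
  exists (b : K -> H) (p : K -> K -> seq H),
    [/\ injective b,
        forall x y, x -- y -> p y x = rev (p x y),
        forall x y, x -- y ->
          uniq (p x y) /\ (forall z, b z \notin p x y),
        forall x y x' y' v, x -- y -> x' -- y' ->
          v \in p x y -> v \in p x' y' ->
          (x' = x /\ y' = y) \/ (x' = y /\ y' = x)
      & (forall v, (exists x, v = b x) \/
                   (exists x y, x -- y /\ v \in p x y)) /\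
        (forall u v, u -- v <->
           exists x y, x -- y /\
             consecutive (b x :: rcons (p x y) (b y)) u v)].

Definition contains_K4_with_skeleton (S G : sgraph) : Prop :=
  exists H : sgraph,
    [/\ subdivision (complete_graph 4) H,
        isomorphic (skeleton H) S
      & subgraph H G].

Definition AstarSP (G : sgraph) : Prop :=
  [/\ ~ contains_K4_with_skeleton (path_graph 3) G,
      ~ contains_K4_with_skeleton (path_graph 4) G
    & ~ contains_K4_with_skeleton (cycle_graph 4) G].

Definition proper_coloring (G : sgraph) (k : nat) (f : G -> 'I_k) : Prop :=
  forall x y, x -- y -> f x != f y.

(* Random access machine over the natural numbers, with registers and a memory;
   operands are register numbers. An instruction takes one unit of time. Addition
   and truncated subtraction lengthen numbers by at most one bit per step, so
   polynomial time is the same as for Turing machines; this would be false with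
   a multiplication instruction. *)
Inductive instr :=
| Const of nat & nat         (* Const r c : r := c *)
| Add of nat & nat & nat     (* Add r a b : r := a + b *)
| Sub of nat & nat & nat     (* Sub r a b : r := a - b *)
| Read of nat & nat          (* Read r a : r := mem[a] *)
| Write of nat & nat         (* Write a r : mem[a] := r *)
| JumpZero of nat & nat.     (* JumpZero r l : if r = 0 then goto l *)

Definition program := seq instr.

Record config := Config {
  pc : nat;
  reg : nat -> nat;
  mem : nat -> nat
}.

Definition exec (i : instr) (s : config) : config :=
  let: Config l r m := s in
  match i with
  | Const x c => Config l.+1 [eta r with x |-> c] m
  | Add x a b => Config l.+1 [eta r with x |-> r a + r b] m
  | Sub x a b => Config l.+1 [eta r with x |-> r a - r b] m
  | Read x a => Config l.+1 [eta r with x |-> m (r a)] m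
  | Write a x => Config l.+1 r [eta m with r a |-> r x]
  | JumpZero x l' => Config (if r x == 0 then l' else l.+1) r m
  end.

(* The machine halts when the program counter leaves the program. *)
Definition step (P : program) (s : config) : config :=
  if onth P (pc s) is Some i then exec i s else s.

Definition halted (P : program) (s : config) : bool := size P <= pc s.

(* Words are passed in memory cells 0, 1, ..., with their length in register
   0, both for input and for output. *)
Definition initial (w : seq nat) : config :=
  Config 0 [eta (fun=> 0) with 0 |-> size w] (nth 0 w).

Definition output (s : config) : seq nat := mkseq (mem s) (reg s 0).

(* A search problem R on the instances x : T satisfying the promise D, with x
   given as the word code x. The entries of code x should be bounded by a
   polynomial in its size, which is then a proper measure of the input. *)
Definition poly_time_solvable (T : Type) (code : T -> seq nat)
    (D : T -> Prop) (R : T -> seq nat -> Prop) : Prop :=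
  exists (P : program) (c d : nat), forall x : T, D x ->
    exists2 t : nat, t <= c * size (code x) ^ d + c &
      let s := iter t (step P) (initial (code x)) in
      halted P s /\ R x (output s).

(* Number of vertices followed by the adjacency matrix. *)
Definition graph_code (G : sgraph) : seq nat :=
  #|G| :: [seq nat_of_bool (x -- y) | x <- enum G, y <- enum G].

Definition colorable_in_poly_time (k : nat) (D : sgraph -> Prop) : Prop :=
  poly_time_solvable graph_code D
    (fun G w => exists2 f : G -> 'I_k, proper_coloring f &
                  w = [seq nat_of_ord (f x) | x <- enum G]).

(* Main.v *)
Require Import Defs.
From mathcomp Require Import all_boot zify.

Set Implicit Arguments.
Unset Strict Implicit.
Unset Printing Implicit Defensive.

(** Let a subdivision of K4 have branch vertices a, b, c, d such that the paths
    b-a and b-c are single edges while the opposite paths a-c and b-d both have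
    inner vertices.  Whatever the two remaining paths a-d and c-d are, its
    skeleton is P3, P4 or C4, according to how many of them are single edges; and
    every subdivision of K4 with one of these skeletons arises so.  Such a
    subdivision is called bent here ([bent_K4], [has_bent_K4_contains]).

    The heart of the matter is that a graph in which all vertices of a nonempty
    set W have at least 4 neighbours in W contains a bent K4 or K5
    ([bent_K4_or_K5_in]).  Take a longest path q0 q1 q2 ... inside W, and among
    the longest ones a path whose last neighbour ql of q0 has the least index l.
    If qi is a neighbour of q0, reversing the part before qi gives another longest
    path, from q(i-1) to the same end and with the same vertices from qi on; so
    the minimality of l gives q(i-1) a neighbour of index at least l.  When
    3 <= i <= l-2, the edges from q0 to qi and ql and this last edge complete the
    path to a bent K4.  Otherwise, having 4 neighbours, q0 is adjacent exactly to
    q1, q2, q(l-1), ql.  If l >= 5, the late neighbours of q1 and q(l-2) yield a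
    bent K4 again; if l = 4, all of q0, ..., q3 start longest paths, and
    either those with neighbours beyond q4 yield a bent K4, or the
    first five vertices form K5
    ([bent_K4_or_K5_on_path]).

    Hence in a graph of the class every nonempty set of vertices has a member
    with at most 3 neighbours inside it, and greedy colouring with 4 colours
    works.  The program proceeds in n rounds.  In each, all vertices that have
    at most 3 neighbours among the vertices present at the start of the round
    leave, and are stamped with the number of the round; the rounds are counted
    downwards, so that every vertex has at most 3 neighbours whose stamp does not
    exceed its own ([stamped_round]).  Colouring the vertices by increasing
    stamps, in any order within a round, never uses up the 4 colours
    ([exists_free]).

    The machine code is compiled from commands whose only loop runs n times, so
    that the running time is bounded by a polynomial whose degree is the nesting
    depth ([compile_correct]); what the commands do is then a matter of loop
    invariants ([For_ind], [main_colors]). *)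

(** * Bent subdivisions of K4 along a path *)

Definition bent_K4 (T : eqType) (e : rel T) (a b c d : T) (ac bd ad cd : seq T) :=
  [/\ e b a && e b c, (ac != [::]) && (bd != [::]),
      path e a (rcons ac c) && path e b (rcons bd d),
      path e a (rcons ad d) && path e c (rcons cd d)
    & uniq ([:: a; b; c; d] ++ ac ++ bd ++ ad ++ cd)].

Definition has_bent_K4 (T : eqType) (e : rel T) :=
  exists a b c d ac bd ad cd, @bent_K4 T e a b c d ac bd ad cd.

Lemma path_all (T : eqType) (e : rel T) (P : pred T) x s :
  (forall u v, e u v -> P v) -> path e x s -> all P s.
Proof.
by move=> eP; elim: s x => //= y s IH x /andP[/eP -> /IH].
Qed.

(** Bent K4s are found among the indices of a path, where disjointness is
    arithmetic, and then carried over to the vertices of the path. *)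
Lemma has_bent_K4_map (T U : eqType) (e : rel T) (e' : rel U) (q : T -> U) (P : pred T) :
  (forall x y, e x y -> [/\ P x, P y & e' (q x) (q y)]) -> {in P &, injective q} ->
  has_bent_K4 e -> has_bent_K4 e'.
Proof.
move=> eP q_inj [a [b [c [d [ac [bd [ad [cd [/andP[ba bc]]]]]]]]]].
case/andP=> ac0 bd0 /andP[pac pbd] /andP[pad pcd] us.
have path_q x s : path e x s -> path e' (q x) (map q s).
  by elim: s x => //= y s IH x /andP[/eP[_ _ ->] /IH].
have PA x s y : path e x (rcons s y) -> all P s /\ P y.
  have eP2 u v : e u v -> P v by case/eP.
  by move/(path_all eP2); rewrite all_rcons => /andP[].
exists (q a), (q b), (q c), (q d), (map q ac), (map q bd), (map q ad), (map q cd).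
have [Pb Pa _] := eP _ _ ba; have [_ Pc _] := eP _ _ bc.
have [Pac _] := PA _ _ _ pac; have [Pbd Pd] := PA _ _ _ pbd.
have [Pad _] := PA _ _ _ pad; have [Pcd _] := PA _ _ _ pcd.
have nilq (s : seq T) : s != [::] -> map q s != [::] by case: s.
split; rewrite -?map_rcons ?path_q ?nilq //.
  by have [_ _ ->] := eP _ _ ba; have [_ _ ->] := eP _ _ bc.
have -> : [:: q a; q b; q c; q d] = map q [:: a; b; c; d] by [].
have /allP all_P : all P ([:: a; b; c; d] ++ ac ++ bd ++ ad ++ cd).
  by rewrite !all_cat Pac Pbd Pad Pcd /= Pa Pb Pc Pd.
by rewrite -!map_cat map_inj_in_uniq // => x y /all_P xP /all_P yP; apply: q_inj.
Qed.

Lemma iota_nil x n : (iota x n == [::]) = (n == 0).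
Proof. by case: n. Qed.

Lemma rev_nil (T : eqType) (s : seq T) : (rev s == [::]) = (s == [::]).
Proof. by rewrite -!size_eq0 size_rev. Qed.

Lemma uniq_consI (T : eqType) (x : T) s :
  uniq s -> (forall y, y \in s -> y != x) -> uniq (x :: s).
Proof. by move=> us xs; rewrite /= us andbT; apply/negP => /xs; rewrite eqxx. Qed.

Lemma uniq_catI (T : eqType) (s1 s2 : seq T) :
  uniq s1 -> uniq s2 -> (forall y, y \in s2 -> y \notin s1) -> uniq (s1 ++ s2).
Proof. by move=> u1 u2 d; rewrite cat_uniq u1 u2 andbT; apply/hasPn. Qed.

(** Disjointness of inner paths that are intervals of indices. *)
Ltac disj :=
  repeat first [done | exact: iota_uniq | rewrite rev_uniq
               | apply: uniq_catI | apply: uniq_consI];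
  move=> ?; rewrite ?(mem_cat, mem_rev, mem_iota, in_nil, inE); lia.

(** Below, [E i j] stands for the adjacency of the vertices of indices [i] and [j]
    of a path on [m] vertices. *)
Section Runs.
Variables (E : rel nat) (m : nat).
Hypothesis Esym : symmetric E.
Hypothesis Estep : forall i, i.+1 < m -> E i i.+1.

Lemma Eprev i j : j = i.+1 -> j < m -> E i j.
Proof. by move=> -> ; apply: Estep. Qed.

Lemma Enext i j : i = j.+1 -> i < m -> E i j.
Proof. by rewrite Esym; apply: Eprev. Qed.

Lemma path_up x n y : x + n < m -> E (x + n) y ->
  path E x (rcons (iota x.+1 n) y).
Proof.
elim: n x => [|n IH] x /=; first by rewrite addn0 => _ ->.
move=> h hy; rewrite Estep ?IH //; first lia; first by rewrite addSnnS.
lia.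
Qed.

Lemma path_down x n y : x + n < m -> E y (x + n) ->
  path E y (rcons (rev (iota x.+1 n)) x).
Proof.
elim: n y => [|n IH] y; first by rewrite addn0 /= => _ ->.
move=> h hy; rewrite -[n.+1]addn1 iotaD rev_cat /= addSnnS hy IH //; first lia.
by rewrite addnS Esym Estep // -addnS.
Qed.

Lemma path_up_to x y : x < y < m -> path E x (rcons (iota x.+1 (y - x.+1)) y).
Proof.
move=> h; apply: path_up; first lia.
have {2}-> : y = (x + (y - x.+1)).+1 by lia.
apply: Estep; lia.
Qed.

Lemma path_down_to x y : x < y < m ->
  path E y (rcons (rev (iota x.+1 (y - x.+1))) x).
Proof.
move=> h; apply: path_down; first lia.
have {1}-> : y = (x + (y - x.+1)).+1 by lia.
rewrite Esym; apply: Estep; lia.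
Qed.

Lemma path_jump x k y : x <= k < m -> E y k ->
  path E y (rcons (rev (iota x.+1 (k - x))) x).
Proof. move=> h hy; apply: path_down; first lia. by rewrite subnKC; lia. Qed.

(** The branch vertices are [i], 0, [l], [i - 1]. The stretches of the path from 0
    to [i - 1] and from [i] to [l] are the opposite pair with inner vertices, and
    [i - 1] reaches [l] by the edge to [k] and then down the path. *)
Lemma bent_inner_chord l i k : 3 <= i -> i.+2 <= l -> l <= k < m ->
  E 0 i -> E 0 l -> E i.-1 k -> has_bent_K4 E.
Proof.
move=> hi il lk e0i e0l eik.
exists i, 0, l, i.-1, (iota i.+1 (l - i.+1)), (iota 1 (i - 2)), [::],
  (iota l.+1 (k - l)).
split; [by apply/andP | rewrite !iota_nil; lia | | | by disj].
  apply/andP; split; first by apply: path_up_to; lia.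
  have -> : i - 2 = i.-1 - 1 by lia.
  by apply: path_up_to; lia.
rewrite /=; apply/andP; split.
  by rewrite Enext; lia.
by apply: path_up; rewrite ?subnKC 1?Esym; lia.
Qed.

(** This lemma and the next two cover the case that 0 has the neighbours 1, 2,
    [l - 1], [l], while 1 and [l - 2] have late neighbours [k] and [k']. Here one of
    these is [l] itself,
    and the other is joined to [l] along the path, so that [l] serves as a branch
    vertex, with 0, 2 and [l - 2]. *)
Lemma bent_meet l k k' : 5 <= l -> l <= k < m -> l <= k' < m ->
  k = l \/ k' = l -> E 0 2 -> E 0 l.-1 -> E 0 l -> E 1 k -> E (l - 2) k' -> has_bent_K4 E.
Proof.
move=> hl lk lk' kk e02 e0l1 e0l e1k elk'.
exists 2, 0, l, (l - 2), (1 :: rev (iota l.+1 (k - l))), [:: l.-1],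
  (iota 3 (l - 5)), (iota l.+1 (k' - l)).
split; [by apply/andP | by [] | | | by disj].
  by rewrite /= e0l1 (@Enext 2 1) ?(@Enext l.-1 (l - 2)) ?path_jump //; lia.
apply/andP; split.
  by rewrite (_ : l - 5 = l - 2 - 3); last lia; apply: path_up_to; lia.
by apply: path_up; rewrite ?subnKC 1?Esym; lia.
Qed.

(** The branch vertices are 0, 1, [k], [l - 2]; the edge from 0 to [l] and the path
    from [l] up to [k] form one of the two paths that must have inner vertices. *)
Lemma bent_cross l k k' : 5 <= l -> l < k <= k' -> k' < m ->
  E 0 l.-1 -> E 0 l -> E 1 k -> E (l - 2) k' -> has_bent_K4 E.
Proof.
move=> hl lk lk' e0l1 e0l e1k elk'.
exists 0, 1, k, (l - 2), (iota l (k - l)), (iota 2 (l - 4)), [:: l.-1],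
  (iota k.+1 (k' - k)).
split; [ | rewrite !iota_nil; lia | | | by disj].
- by rewrite e1k Enext; lia.
- apply/andP; split.
    rewrite (_ : k - l = (k - l.+1).+1); last lia.
    by rewrite /= e0l path_up_to; lia.
  by rewrite (_ : l - 4 = l - 2 - 2); last lia; apply: path_up_to; lia.
apply/andP; split.
  rewrite /= e0l1 Enext; lia.
by apply: path_up; rewrite ?subnKC 1?Esym; lia.
Qed.

(** The branch vertices are [l - 1], [l - 2], [k'], 0; the path from [k'] to 0 runs
    up to [k] and back through 1. *)
Lemma bent_nested l k k' : 5 <= l -> l < k' < k -> k < m ->
  E 0 2 -> E 0 l.-1 -> E 0 l -> E 1 k -> E (l - 2) k' -> has_bent_K4 E.
Proof.
move=> hl lk lk' e02 e0l1 e0l e1k elk'.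
exists l.-1, (l - 2), k', 0, (iota l (k' - l)), (rcons (rev (iota 3 (l - 5))) 2), [::],
  (rcons (iota k'.+1 (k - k')) 1).
rewrite /bent_K4 -!cats1.
split; [ | rewrite iota_nil; case: rev => //= *; lia | | | by disj].
- by rewrite elk' Eprev; lia.
- apply/andP; split.
    rewrite (_ : k' - l = (k' - l.+1).+1); last lia.
    rewrite cats1 /= Eprev ?path_up_to; lia.
  rewrite !cats1 rcons_path last_rcons Esym e02 andbT.
  by rewrite (_ : l - 5 = l - 2 - 3); last lia; apply: path_down_to; lia.
rewrite /= Esym e0l1 /= !cats1 rcons_path last_rcons Enext ?andbT; try lia.
by apply: path_up; rewrite ?subnKC 1?Esym; lia.
Qed.

(** Vertices 0 and 2 are both adjacent to 1 and 3. The edge from 0 to 4 continues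
    upwards until it meets the path that joins 1 and 3 through [k] and [k']; the
    meeting point, the smaller of the two, is the fourth branch vertex. *)
Lemma bent_diamond k k' : 4 < k < m -> 4 < k' < m ->
  E 0 3 -> E 0 4 -> E 1 k -> E 3 k' -> has_bent_K4 E.
Proof.
move=> hk hk' e03 e04 e1k e3k.
have [d hd] : exists d, d = minn k k' by exists (minn k k').
exists 1, 0, 3, d, [:: 2], (iota 4 (d - 4)), (rev (iota d.+1 (k - d))),
  (rev (iota d.+1 (k' - d))).
split; [ | rewrite /= iota_nil; lia | | | by disj].
- by rewrite e03 Eprev; lia.
- rewrite /= !Estep /=; try lia.
  rewrite (_ : d - 4 = (d - 5).+1) /= ?e04 ?path_up_to //; lia.
by rewrite !path_jump //; lia.
Qed.

(** The vertices 0, 1, 2, 3 are pairwise adjacent, 0 and 3 are adjacent to 4, and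
    one of 1 and 2 is joined to 4 by a longer path: a K5 with one edge
    subdivided, minus some edges, contains a bent K4. *)
Lemma bent_clique k x y : 4 < k < m -> x \in [:: 1; 2] -> y = 3 - x ->
  E 0 3 -> E 0 4 -> E 0 y -> E 0 x -> E x 3 -> E y 3 -> E x k -> has_bent_K4 E.
Proof.
move=> hk; rewrite !inE => hx hy e03 e04 e0y e0x ex3 ey3 exk.
exists 4, 0, x, 3, (iota 5 (k - 4)), [:: y], [::], [::].
split; [ | rewrite /= iota_nil; lia | | | by disj].
- by rewrite e04.
- rewrite path_up //= ?subnKC ?e0y //; try lia. by rewrite Esym.
by rewrite /= Enext ?ex3; lia.
Qed.

(** The hypotheses on [E i.-1] express that the reversal of the part of the path
    before [i] leads to a path of the same kind, starting at [i - 1]. *)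
Lemma bent_K4_or_K5_on_path l :
    irreflexive E -> l < m -> (forall k, E 0 k -> k <= l) -> E 0 l ->
    (forall i, 0 < i <= l -> E 0 i -> exists2 k, l <= k < m & E i.-1 k) ->
    (forall i s, 0 < i <= l -> E 0 i -> size s <= 3 ->
       exists2 k, k < m & E i.-1 k && (k \notin s)) ->
  has_bent_K4 E \/ 5 <= m /\ forall i j, i < j < 5 -> E i j.
Proof.
move=> Eirr lm Emax e0l rot deg.
have e0 i : E 0 i -> i != 0 by move=> e; apply/eqP => i0; rewrite i0 Eirr in e.
have l0 := e0 _ e0l.
have e01 : E 0 1 by apply: Estep; lia.
case: (boolP (has (fun i => E 0 i) (iota 3 (l - 4)))) => [/hasP[i]|/hasPn far].
  rewrite mem_iota => hi e0i; left; have [|k hk eik] := rot i _ e0i; first lia.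
  by apply: (@bent_inner_chord l i k); lia.
(* With at least 4 neighbours among these, 0 is adjacent to all of them. *)
have ends k : E 0 k -> k \in [:: 1; 2; l.-1; l].
  move=> e; have := Emax _ e; have := e0 _ e; have := far k.
  rewrite mem_iota e !inE /=; lia.
have [|k km /andP[e02]] := deg 1 [:: 1; l.-1; l] _ e01 isT; first lia.
have := ends _ e02; rewrite !inE => kE kN; have k2 : k = 2 by lia.
have {}l0 : 4 <= l by have := Emax _ e02; lia.
subst k; clear kE kN km.
have [|k km /andP[e0l1]] := deg 1 [:: 1; 2; l] _ e01 isT; first lia.
have := ends _ e0l1; rewrite !inE => kE kN; have kl : k = l.-1 by lia.
subst k; clear kE kN km.
have [|k hk e1k] := rot 2 _ e02; first lia.
have [|k' hk' elk'] := rot l.-1 _ e0l1; first lia.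
rewrite (_ : l.-1.-1 = l - 2) in elk'; last lia.
case: (leqP 5 l) => hl.
  left; case: (boolP ((k == l) || (k' == l))) => kk.
    by apply: (@bent_meet l k k') => //; lia.
  case: (leqP k k') => kk'.
    by apply: (@bent_cross l k k') => //; lia.
  by apply: (@bent_nested l k k') => //; lia.
(* The first four vertices are the starts of longest paths. If 1 and 3 are
   adjacent, they form a clique together with 0 and 2; otherwise 1 and 3 both
   need a neighbour beyond 4 to have 4 of them. *)
have l4 : l = 4 by lia.
subst l; rewrite /= in e0l1 elk'.
have e23 : E 2 3 by apply: Estep; lia.
case: (boolP (E 1 3)) => e13.
  case: (ltngtP k 4) => k4; first lia.
    by left; apply: (@bent_clique k 1 2) => //; lia.
  case: (ltngtP k' 4) => k'4; first lia.
    by left; apply: (@bent_clique k' 2 1) => //; lia.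
  subst k k'; right; split=> // i j.
  case: i => [|[|[|[|i]]]]; case: j => [|[|[|[|[|j]]]]] h //;
    first [by apply: Estep; lia | lia].
left.
have [|j jm /andP[e1j]] := deg 2 [:: 0; 2; 4] _ e02 isT; first lia.
have [|j' j'm /andP[e3j]] := deg 4 [:: 0; 2; 4] _ e0l isT; first lia.
rewrite /= in e1j e3j; rewrite !inE => hj' hj.
have j1 : (j != 1) && (j != 3).
  by apply/andP; split; apply/eqP => jE; subst j; rewrite ?Eirr ?(negPf e13) in e1j.
have j3 : (j' != 1) && (j' != 3).
  apply/andP; split; apply/eqP => jE; subst j'; first by rewrite Esym (negPf e13) in e3j.
  by rewrite Eirr in e3j.
by apply: (@bent_diamond j j') => //; lia.
Qed.

End Runs.

(** * Longest paths under rotation *)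
Section LongestPath.
Variables (G : sgraph) (W : {set G}).
Hypothesis Wdeg : forall x, x \in W -> 3 < #|[set y in W | x -- y]|.

Definition W_path (s : seq G) := [&& uniq s, sorted (@sedge G) s & all [in W] s].

Lemma longest_W_path x : x \in W -> exists2 m, 0 < m &
  (exists s : m.-tuple G, W_path s) /\ forall s, W_path s -> size s <= m.
Proof.
move=> xW; pose P m := [exists s : m.-tuple G, W_path s].
have P1 : exists m, P m.
  by exists 1; apply/existsP; exists [tuple x]; rewrite /W_path /= xW.
have PE s : W_path s -> P (size s).
  by move=> sW; apply/existsP; exists (in_tuple s).
have PB m : P m -> m <= #|G|.
  by case/existsP => s /andP[us _]; rewrite -(size_tuple s) -(card_uniqP us) max_card.
have [m /existsP[s sW] mmax] := ex_maxnP P1 PB.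
exists m; last by split; [exists s | move=> s' /PE/mmax].
have := mmax 1; apply; apply: (PE [:: x]).
by rewrite /W_path /= xW.
Qed.

(** Rotation in the sense of Posa. *)
Lemma rotate_W_path x p y r :
  W_path ((x :: p) ++ y :: r) -> x -- y -> W_path (rev (x :: p) ++ y :: r).
Proof.
case/and3P=> us es Ws exy; apply/and3P; split.
- have: perm_eq (rev (x :: p) ++ y :: r) ((x :: p) ++ y :: r).
    by rewrite perm_cat2r perm_rev.
  by move/perm_uniq ->.
- move: es; rewrite !sorted_cat_cons -rev_cons rev_sorted /= rcons_path.
  case/andP=> /andP[es _] ->; rewrite exy andbT.
  by rewrite (eq_path (e' := @sedge G)) // => u v; rewrite sedge_sym.
- by move: Ws; rewrite !all_cat all_rev.
Qed.

Lemma W_path_cons y s : W_path s -> y \in W -> y \notin s ->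
  (if s is z :: _ then z -- y else true) -> W_path (y :: s).
Proof.
rewrite /W_path /= => /and3P[-> es ->] -> -> /= h; rewrite andbT.
by case: s es h => //= z s ->; rewrite sedge_sym => ->.
Qed.

Lemma rotate_at x0 s i : W_path s -> 0 < i < size s -> nth x0 s 0 -- nth x0 s i ->
  exists s', [/\ W_path s', perm_eq s' s, nth x0 s' 0 = nth x0 s i.-1
    & forall j, i <= j -> nth x0 s' j = nth x0 s j].
Proof.
move=> sW hi e; exists (rev (take i s) ++ drop i s); split.
- case: s sW hi e => // z s sW /andP[]; case: i => // i _.
  rewrite ltnS => hi /= e.
  rewrite (drop_nth x0) //; apply: rotate_W_path => //=.
  by rewrite -drop_nth // cat_take_drop.
- by rewrite -{3}(cat_take_drop i s) perm_cat2r perm_rev.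
- have si : size (take i s) = i by rewrite size_takel; lia.
  rewrite nth_cat size_rev si; case: ifP; last lia.
  by move=> i0; rewrite nth_rev si // nth_take subn1; last lia.
- move=> j hj; have si : size (take i s) = i by rewrite size_takel; lia.
  by rewrite nth_cat size_rev si ltnNge hj /= nth_drop subnKC.
Qed.

(** Minimising the bound [k] of [reach k] over the longest paths amounts to choosing
    one whose start has its last neighbour as early as possible. *)
Lemma bent_K4_or_K5_in x : x \in W ->
  has_bent_K4 (@sedge G) \/ subgraph (complete_graph 5) G.
Proof.
move=> xW; have [m m0 [exm maxm]] := longest_W_path xW.
have on_path s y : W_path s -> size s = m -> y \in W -> nth x s 0 -- y -> y \in s.
  move=> sW sm yW ey; apply/negPn/negP => ys.
  have: W_path (y :: s).
    by apply: W_path_cons => //; case: (s) ey.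
  by move/maxm; rewrite /= sm ltnn.
pose reach k (s : m.-tuple G) :=
  [forall y in W, (nth x s 0 -- y) ==> (y \in take k.+1 s)].
have exr : exists k, [exists s : m.-tuple G, W_path s && reach k s].
  have [s sW] := exm; exists m; apply/existsP; exists s; rewrite sW.
  apply/forall_inP => y yW; apply/implyP => ey.
  by rewrite take_oversize ?size_tuple // on_path ?size_tuple.
have [l /existsP[s /andP[sW sl]] lmin] := ex_minnP exr.
(* All neighbours of the start in W lie on the path, which could otherwise be
   prolonged. *)
have head_deg s' : W_path s' -> size s' = m -> forall t : seq G, size t <= 3 ->
    exists2 k, k < m & (nth x s' 0 -- nth x s' k) && (nth x s' k \notin t).
  move=> sW' sm' t ts.
  have hW : nth x s' 0 \in W.
    by case/and3P: sW' => _ _ /allP; apply; rewrite mem_nth ?sm'.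
  have: ~~ ([set y in W | nth x s' 0 -- y] \subset t).
    apply/negP => /subset_leq_card h.
    have := leq_trans (Wdeg hW) (leq_trans h (leq_trans (card_size t) ts)).
    by rewrite ltnn.
  case/subsetPn => y; rewrite inE => /andP[yW ey] yt.
  have ys := on_path _ _ sW' sm' yW ey.
  by exists (index y s'); rewrite -?sm' ?index_mem // nth_index // ey.
(* By the minimality of [l]. *)
have far s' : W_path s' -> size s' = m ->
    exists2 k, l <= k < m & nth x s' 0 -- nth x s' k.
  move=> sW' sm'; have [k0 k0m /andP[ek0 _]] := head_deg _ sW' sm' [::] isT.
  case: l lmin sl => [|l'] lmin _; first by exists k0.
  case: (boolP (has (fun k => nth x s' 0 -- nth x s' k) (iota l'.+1 (m - l'.+1)))).
    by case/hasP=> k; rewrite mem_iota => hk ek; exists k => //; lia.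
  move/hasPn => none.
  have: l' < l' ; last by rewrite ltnn.
  apply: lmin; have sz : size s' == m by apply/eqP.
  apply/existsP; exists (Tuple sz); rewrite /= sW'.
  apply/forall_inP => y yW; apply/implyP => /= ey.
  have ys := on_path _ _ sW' sm' yW ey.
  have im : index y s' < m by rewrite -sm' index_mem.
  rewrite in_take //; apply/negPn/negP => hy.
  have := none (index y s'); rewrite mem_iota nth_index // ey.
  by move=> h; have := h; lia.
pose q := nth x s; have sm : size s = m by rewrite size_tuple.
pose E i j := [&& i < m, j < m & q i -- q j].
have Esym : symmetric E by move=> i j; rewrite /E sedge_sym andbCA.
have Estep i : i.+1 < m -> E i i.+1.
  move=> im; case/and3P: sW => _ /(sortedP x) es _.
  by rewrite /E im ltnW //= es ?sm.
have Eirr : irreflexive E by move=> i; rewrite /E sedge_irr !andbF.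
have q_inj i j : i < m -> j < m -> q i = q j -> i = j.
  case/and3P: sW => us _ _ im jm /eqP.
  by rewrite nth_uniq ?sm // => /eqP.
have Emax k : E 0 k -> k <= l.
  case/and3P=> _ km ek; have /forall_inP/(_ (q k)) := sl.
  have kW : q k \in W.
    by case/and3P: sW => _ _ /allP; apply; rewrite mem_nth ?sm.
  move/(_ kW)/implyP/(_ ek).
  have us: uniq s by case/and3P: sW.
  by rewrite in_take ?index_uniq ?mem_nth ?sm.
have [l' hl' el'] := far _ sW sm.
have E0l' : E 0 l' by rewrite /E m0 el'; lia.
have ll : l' = l by have := Emax _ E0l'; lia.
subst l'.
have rot i : 0 < i <= l -> E 0 i -> exists2 k, l <= k < m & E i.-1 k.
  move=> hi /and3P[_ im ei]; have [|s' [sW' ps' s'0 s'j]] := rotate_at sW _ ei.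
    by rewrite sm; lia.
  have sm' : size s' = m by rewrite (perm_size ps').
  have [k hk ek] := far _ sW' sm'; exists k => //.
  by rewrite /E /q -s'0 -s'j ?ek; lia.
have deg i t : 0 < i <= l -> E 0 i -> size t <= 3 ->
    exists2 k, k < m & E i.-1 k && (k \notin t).
  move=> hi /and3P[_ im ei] st; have [|s' [sW' ps' s'0 s'j]] := rotate_at sW _ ei.
    by rewrite sm; lia.
  have sm' : size s' = m by rewrite (perm_size ps').
  have [|k km /andP[ek kt]] := head_deg _ sW' sm' (map q t).
    by rewrite size_map.
  have ks : nth x s' k \in s by rewrite -(perm_mem ps') mem_nth ?sm'.
  have im' : index (nth x s' k) s < m by rewrite -{2}sm index_mem.
  exists (index (nth x s' k) s) => //.
  rewrite /E /q nth_index // -s'0 ek im' /= andbT; apply/andP; split; first lia.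
  by apply: contra kt => /(map_f q); rewrite /q nth_index.
case: (bent_K4_or_K5_on_path Esym Estep Eirr _ Emax E0l' rot deg); first lia.
  move=> fr; left; apply: (has_bent_K4_map (q := q) (P := fun i => i < m)) fr.
    by move=> i j /and3P[].
  by move=> i j; apply: q_inj.
case=> m5 hK; right; exists (fun i : 'I_5 => q i).
  move=> i j /q_inj ij; apply: val_inj; apply: ij; exact: leq_trans (ltn_ord _) m5.
move=> i j; rewrite /= /complete_rel neq_ltn => /orP[] ij; last rewrite sedge_sym.
  by have /and3P[] : E i j by apply: hK; rewrite ij ltn_ord.
by have /and3P[] : E j i by apply: hK; rewrite ij ltn_ord.
Qed.

End LongestPath.

(** * Subdivisions inside a graph, and their skeletons *)

Section Consecutive.
Variable T : eqType.
Implicit Types (s : seq T) (u v x : T).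

Lemma consecutive_cons x y s u v :
  consecutive (x :: y :: s) u v = ((u == x) && (v == y)) || consecutive (y :: s) u v.
Proof. by rewrite /consecutive /= inE xpair_eqE. Qed.

Lemma consecutiveP s u v :
  reflect (exists s1 s2, s = s1 ++ [:: u, v & s2]) (consecutive s u v).
Proof.
elim: s => [|x s IH]; first by apply: ReflectF => -[[|? ?] [? //]].
case: s IH => [|y s] IH.
  by apply: ReflectF => -[[|? [|? ?]] [? //]].
rewrite consecutive_cons; apply: (iffP orP).
  case=> [/andP[/eqP-> /eqP->]|/IH[s1 [s2 ->]]]; first by exists [::], s.
  by exists (x :: s1), s2.
case=> -[|z s1] [s2] /= [-> e]; first by left; rewrite !eqxx; case: e => ->; rewrite eqxx.
by right; apply/IH; exists s1, s2.
Qed.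

Lemma consecutive_rev s u v : consecutive (rev s) u v = consecutive s v u.
Proof.
suff imp s' x y : consecutive s' x y -> consecutive (rev s') y x.
  by apply/idP/idP => /imp; rewrite ?revK.
case/consecutiveP=> s1 [s2 ->]; apply/consecutiveP; exists (rev s2), (rev s1).
by rewrite rev_cat !rev_cons -!cats1 -!catA.
Qed.

Lemma consecutive_path e x s u v : path e x s -> consecutive (x :: s) u v -> e u v.
Proof.
elim: s x => [|y s IH] x //= /andP[exy /IH es].
by rewrite consecutive_cons => /orP[/andP[/eqP-> /eqP->]|].
Qed.

Lemma consecutive_memr x s u v : consecutive (x :: s) u v -> v \in s.
Proof.
elim: s x => [|y s IH] x //; rewrite consecutive_cons inE.
by case/orP=> [/andP[_ ->]|/IH ->]; rewrite ?orbT.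
Qed.

Lemma consecutive_meml x s u v : consecutive (rcons s x) u v -> u \in s.
Proof. by rewrite -consecutive_rev rev_rcons => /consecutive_memr; rewrite mem_rev. Qed.

(** Only an unsubdivided path joins two of its vertices that are both outside its
    interior. *)
Lemma consecutive_ends a s c u v : consecutive (a :: rcons s c) u v ->
  u \notin s -> v \notin s -> [/\ s = [::], u = a & v = c].
Proof.
case: s => [|z t] /=.
  by rewrite /consecutive /= !inE xpair_eqE => /andP[/eqP-> /eqP->].
rewrite consecutive_cons => /orP[/andP[_ /eqP->]|]; first by rewrite mem_head.
by rewrite -rcons_cons => /consecutive_meml ->.
Qed.

Lemma consecutive_next s u v x0 : uniq s -> consecutive s u v ->
  v = nth x0 s (index u s).+1 /\ u = nth x0 s (index v s).-1.
Proof.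
move=> us /consecutiveP[s1 [s2 sE]].
have sz : (size s1).+1 < size s by rewrite sE size_cat /= !addnS !ltnS leq_addr.
have nu : nth x0 s (size s1) = u by rewrite sE nth_cat ltnn subnn.
have nv : nth x0 s (size s1).+1 = v by rewrite sE nth_cat ltnNge leqnSn subSnn.
have -> : index u s = size s1 by rewrite -nu index_uniq // ltnW.
by have -> : index v s = (size s1).+1 by rewrite -nv index_uniq.
Qed.

End Consecutive.

Lemma consecutive_map (T U : eqType) (f : T -> U) s u v : injective f ->
  consecutive (map f s) (f u) (f v) = consecutive s u v.
Proof.
move=> fi; elim: s => [|x [|y s] IH] //=.
by rewrite consecutive_cons IH consecutive_cons !(inj_eq fi).
Qed.

(** A system of internally disjoint paths in G between the images of the vertices
    of K, one for each edge of K, spans a subgraph of G that is a subdivision of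
    K. *)
Section SubdivisionIn.
Variables (K G : sgraph) (b : K -> G) (p : K -> K -> seq G).
Hypothesis b_inj : injective b.
Hypothesis p_rev : forall x y, x -- y -> p y x = rev (p x y).
Hypothesis p_uniq : forall x y, x -- y -> uniq (p x y) /\ (forall z, b z \notin p x y).
Hypothesis p_disj : forall x y x' y' v, x -- y -> x' -- y' ->
  v \in p x y -> v \in p x' y' -> (x' = x /\ y' = y) \/ (x' = y /\ y' = x).
Hypothesis p_path : forall x y, x -- y ->
  path (@sedge G) (b x) (rcons (p x y) (b y)).

Definition used : pred G := fun v =>
  [exists x, v == b x] || [exists x, exists y, (x -- y) && (v \in p x y)].

Definition linked : rel G := fun u v =>
  [exists x, exists y,
    (x -- y) && consecutive (b x :: rcons (p x y) (b y)) u v].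

Lemma linkedP u v : reflect
  (exists x y, x -- y /\ consecutive (b x :: rcons (p x y) (b y)) u v) (linked u v).
Proof.
apply: (iffP existsP) => [[x /existsP[y /andP[]]]|[x [y [exy c]]]]; first by exists x, y.
by exists x; apply/existsP; exists y; rewrite exy.
Qed.

Lemma linked_sym : symmetric linked.
Proof.
suff imp u v : linked u v -> linked v u by move=> u v; apply/idP/idP => /imp.
case/linkedP=> x [y [exy c]]; apply/linkedP; exists y, x.
split; first by rewrite sedge_sym.
by rewrite (p_rev exy) -rev_cons -rev_rcons rcons_cons consecutive_rev.
Qed.

Lemma linked_sub u v : linked u v -> u -- v.
Proof. by case/linkedP=> x [y [exy c]]; apply: consecutive_path c; apply: p_path. Qed.

Definition usedT : finType := {v : G | used v}.

Lemma usedT_sym : symmetric (relpre (val : usedT -> G) linked).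
Proof. by move=> u v; rewrite /= linked_sym. Qed.

Lemma usedT_irr : irreflexive (relpre (val : usedT -> G) linked).
Proof.
move=> u; apply: contraFF (sedge_irr (val u)); apply: linked_sub.
Qed.

(** This is in general not an induced subgraph of G: only the edges along the
    paths are kept. *)
Definition subdivided : sgraph := SGraph usedT_sym usedT_irr.

Lemma used_b x : used (b x).
Proof. by apply/orP; left; apply/existsP; exists x. Qed.

Lemma used_p x y v : x -- y -> v \in p x y -> used v.
Proof.
move=> exy vp; apply/orP; right; apply/existsP; exists x.
by apply/existsP; exists y; rewrite exy.
Qed.

Definition branch x : subdivided := Sub (b x) (used_b x).
Definition inner x y : seq subdivided := pmap insub (p x y).

Lemma val_inner x y : x -- y -> map val (inner x y) = p x y.
Proof.
move=> exy; rewrite /inner (pmap_filter (@insubK _ _ _)); apply/all_filterP.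
by apply/allP => v /(used_p exy) uv; rewrite isSome_insub.
Qed.

Lemma mem_inner x y v : x -- y -> (v \in inner x y) = (val v \in p x y).
Proof. by move=> exy; rewrite -(val_inner exy) mem_map //; apply: val_inj. Qed.

Lemma subdivided_subdivision : subdivision K subdivided.
Proof.
exists branch, inner; split.
- by move=> x y /(congr1 val)/b_inj.
- move=> x y exy; apply: (inj_map val_inj).
  by rewrite map_rev !val_inner //; [apply: p_rev | rewrite sedge_sym].
- move=> x y exy; have [up bp] := p_uniq exy; split.
    by rewrite -(map_inj_uniq val_inj) val_inner.
  by move=> z; rewrite mem_inner //= bp.
- by move=> x y x' y' v exy exy'; rewrite !mem_inner //; apply: p_disj.
split=> [v|u v].
  case/orP: (valP v) => [/existsP[x /eqP vx]|/existsP[x /existsP[y /andP[exy vp]]]].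
    by left; exists x; apply: val_inj.
  by right; exists x, y; rewrite mem_inner.
have cE x y : x -- y -> consecutive (branch x :: rcons (inner x y) (branch y)) u v =
    consecutive (b x :: rcons (p x y) (b y)) (val u) (val v).
  by move=> exy; rewrite -(consecutive_map _ _ _ val_inj) /= map_rcons val_inner.
split=> [/linkedP|] [x [y [exy c]]]; last apply/linkedP.
  by exists x, y; rewrite cE.
by exists x, y; rewrite -cE.
Qed.

Lemma subdivided_subgraph : subgraph subdivided G.
Proof. by exists val => [|u v]; [apply: val_inj | apply: linked_sub]. Qed.

(** The first vertices of the paths leaving [b x] are distinct. *)
Lemma degree_branch x : degree x <= degree (branch x).
Proof.
pose f y := head (b y) (p x y).
have f_link y : x -- y -> linked (b x) (f y).
  move=> exy; apply/linkedP; exists x, y; split=> //.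
  by rewrite /f; case: (p x y) => [|z t]; rewrite /= consecutive_cons !eqxx.
have f_inj : {in [set y | x -- y] &, injective f}.
  move=> y y'; rewrite !inE => exy exy'.
  have [_ bp] := p_uniq exy; have [_ bp'] := p_uniq exy'.
  rewrite /f; case py: (p x y) => [|z t]; case py': (p x y') => [|z' t'] /=.
  - by move/b_inj.
  - by move=> zE; have := bp' y; rewrite py' zE mem_head.
  - by move=> zE; have := bp y'; rewrite py -zE mem_head.
  move=> zE; case: (p_disj (v := z) exy exy') => [| |[_ -> //]|[xy _]].
  - by rewrite py mem_head.
  - by rewrite py' zE mem_head.
  by rewrite xy sedge_irr in exy.
rewrite /degree -(card_in_imset f_inj) -(card_imset (mem [set v | branch x -- v]) val_inj).
apply: subset_leq_card; apply/subsetP => _ /imsetP[y + ->].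
rewrite inE => /f_link l; have uf : used (f y).
  have := l; rewrite linked_sym.
  case/linkedP => x1 [y1 [e1]].
  rewrite -rcons_cons => /consecutive_meml; rewrite inE => /orP[/eqP->|].
    exact: used_b.
  exact: used_p.
by apply/imsetP; exists (Sub (f y) uf); rewrite // inE.
Qed.

(** Only one path runs through an inner vertex, so that its neighbours are its
    predecessor and its successor there. *)
Lemma degree_inner x y (v : subdivided) : x -- y -> val v \in p x y -> degree v <= 2.
Proof.
move=> exy vp; set L := b x :: rcons (p x y) (b y).
have [up bp] := p_uniq exy.
have uL : uniq L.
  rewrite /= mem_rcons inE rcons_uniq up !bp (negPf (bp x)) orbF !andbT.
  by apply/eqP => /b_inj xy; rewrite xy sedge_irr in exy.
pose next := nth (b x) L (index (val v) L).+1.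
pose prev := nth (b x) L (index (val v) L).-1.
have: [set val w | w in [set w | v -- w]] \subset [set next; prev].
  apply/subsetP => _ /imsetP[w + ->]; rewrite inE => /linkedP[x' [y' [exy' c]]].
  have vp' : val v \in p x' y'.
    move: c; rewrite -rcons_cons => /consecutive_meml; rewrite inE => /orP[/eqP vx|//].
    by have := bp x'; rewrite -vx vp.
  have : consecutive L (val v) (val w) \/ consecutive L (val w) (val v).
    case: (p_disj exy exy' vp vp') => -[xE yE]; subst x' y'; [by left|right].
    by rewrite -consecutive_rev /L rev_cons rev_rcons -(p_rev exy).
  rewrite !inE; case=> /(consecutive_next (b x) uL)[wE vE].
    by rewrite /next -wE eqxx.
  by rewrite /prev -vE eqxx orbT.
move/subset_leq_card; rewrite card_imset; last exact: val_inj.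
by rewrite /degree cards2 => /leq_trans; apply; case: eqP.
Qed.

Hypothesis K_deg : forall x : K, 3 <= degree x.

(** Degrees tell branch vertices from inner ones, since those of K are at least
    3; two branch vertices are adjacent only through an unsubdivided path. *)
Lemma skeletonP (u v : subdivided) : reflect
  (exists x y, [/\ x -- y, p x y = [::], u = branch x & v = branch y])
  (skeleton_rel u v).
Proof.
have deg_branch x : 3 <= degree (branch x) by apply: leq_trans (degree_branch x).
have br (w : subdivided) : 3 <= degree w -> exists x, w = branch x.
  move=> dw; case/orP: (valP w) => /existsP[x]; last first.
    case/existsP=> y /andP[exy wp]; by have := leq_trans dw (degree_inner exy wp).
  by move/eqP=> wx; exists x; apply: val_inj.
apply: (iffP and3P) => [[/linkedP[x' [y' [exy c]]] /br[x ux] /br[y vy]]|]; last first.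
  case=> x [y [exy pxy -> ->]]; split=> //.
  by apply/linkedP; exists x, y; rewrite pxy /= consecutive_cons !eqxx.
subst u v; have [_ bp] := p_uniq exy.
have [pxy /b_inj-> /b_inj->] := consecutive_ends c (bp x) (bp y).
by exists x', y'.
Qed.

(** Up to isomorphism the skeleton is thus the graph of the unsubdivided edges of
    K, without its isolated vertices; [g] embeds a copy [S] of it into K. *)
Lemma skeleton_iso (S : sgraph) (g : S -> K) : injective g ->
  (forall i j, i -- j = (g i -- g j) && (p (g i) (g j) == [::])) ->
  (forall x y, x -- y -> p x y = [::] -> exists i, g i = x) ->
  (forall i : S, exists j, i -- j) ->
  isomorphic (skeleton subdivided) S.
Proof.
move=> g_inj gE g_onto S_nbr.
have ex_i (u : skeleton subdivided) : exists i, val u = branch (g i).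
  case/existsP: (valP u) => v /skeletonP[x [y [exy pxy ux _]]].
  by have [i gi] := g_onto x y exy pxy; exists i; rewrite ux gi.
have [f fE] := fin_all_exists ex_i.
have in_skel i : [exists v, skeleton_rel (branch (g i)) v].
  have [j] := S_nbr i; rewrite gE => /andP[e /eqP pe].
  by apply/existsP; exists (branch (g j)); apply/skeletonP; exists (g i), (g j).
have branch_inj x y : branch x = branch y -> x = y by move/(congr1 val)/b_inj.
exists f.
  exists (fun i => exist _ (branch (g i)) (in_skel i)) => [u|i].
    by apply: (@val_inj _ _ {x : subdivided | [exists y, skeleton_rel x y]}); rewrite /= -fE.
  apply: g_inj; apply: branch_inj.
  by have /= <- := fE (exist _ (branch (g i)) (in_skel i)).
move=> u v; rewrite gE; apply/andP/skeletonP.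
  by case=> e /eqP pe; exists (g (f u)), (g (f v)).
case=> x [y [exy pxy]]; rewrite !fE => /branch_inj-> /branch_inj->.
by rewrite pxy.
Qed.

End SubdivisionIn.

Section BentSubdivision.
Variables (G : sgraph) (a b c d : G) (ac bd ad cd : seq G).
Hypothesis fr : bent_K4 (@sedge G) a b c d ac bd ad cd.

Definition corner (i : 'I_4) : G := nth a [:: a; b; c; d] i.

Definition side (i j : 'I_4) : seq G :=
  match val i, val j with
  | 0, 2 => ac | 2, 0 => rev ac
  | 1, 3 => bd | 3, 1 => rev bd
  | 0, 3 => ad | 3, 0 => rev ad
  | 2, 3 => cd | 3, 2 => rev cd
  | _, _ => [::]
  end.

Notation K4 := (complete_graph 4).

Lemma corner_inj : injective corner.
Proof.
case: fr => _ _ _ _; rewrite cat_uniq => /andP[u _] i j /eqP.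
by rewrite (@nth_uniq _ a [:: a; b; c; d] i j (ltn_ord i) (ltn_ord j) u) => /eqP/val_inj.
Qed.

Lemma side_rev (x y : K4) : x -- y -> side y x = rev (side x y).
Proof.
by case: x y => [[|[|[|[|?]]]] ?] [[|[|[|[|?]]]] ?] //=; rewrite /side /= ?revK.
Qed.

Lemma side_disjoint : [/\ uniq ac, uniq bd, uniq ad & uniq cd] /\
  forall v, [/\ v \in ac -> [|| v \in bd, v \in ad | v \in cd] = false,
    v \in bd -> [|| v \in ad | v \in cd] = false, v \in ad -> (v \in cd) = false
  & v \in ac ++ bd ++ ad ++ cd -> v \notin [:: a; b; c; d]].
Proof.
case: fr => _ _ _ _; rewrite cat_uniq => /and3P[_ /hasPn u0].
rewrite !cat_uniq => /and3P[-> /hasPn u1 /and3P[-> /hasPn u2 /and3P[-> /hasPn u3 ->]]].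
split=> // v; split; last exact: u0.
- apply: contraTF => h; apply: u1; rewrite !mem_cat.
  by case/or3P: h => ->; rewrite ?orbT.
- by apply: contraTF => h; apply: u2; rewrite mem_cat.
by apply: contraTF => h; apply: u3.
Qed.

Lemma side_uniq (x y : K4) : x -- y ->
  uniq (side x y) /\ (forall z, corner z \notin side x y).
Proof.
have [[uac ubd uad ucd] D] := side_disjoint => exy; split.
  by case: x y exy => [[|[|[|[|?]]]] ?] [[|[|[|[|?]]]] ?] //= _; rewrite /side /= ?rev_uniq.
move=> z; apply/negP => zs; have [_ _ _] := D (corner z).
have -> : corner z \in [:: a; b; c; d].
  exact: (@mem_nth _ a [:: a; b; c; d] z (ltn_ord z)).
suff -> : corner z \in ac ++ bd ++ ad ++ cd by move/(_ isT).
rewrite !mem_cat; move: zs.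
by case: x y exy => [[|[|[|[|?]]]] ?] [[|[|[|[|?]]]] ?] //= _;
  rewrite /side /= ?mem_rev => ->; rewrite ?orbT.
Qed.

Lemma side_disj (x y x' y' : K4) v : x -- y -> x' -- y' ->
  v \in side x y -> v \in side x' y' -> (x' = x /\ y' = y) \/ (x' = y /\ y' = x).
Proof.
have [_ /(_ v)[Dac Dbd Dad _]] := side_disjoint.
suff : x -- y -> x' -- y' -> v \in side x y -> v \in side x' y' ->
  (x' == x) && (y' == y) || (x' == y) && (y' == x).
  move=> h e e' s s'; case/orP: (h e e' s s') => /andP[/eqP-> /eqP->]; [by left|by right].
rewrite -!val_eqE.
move: Dac Dbd Dad; rewrite -!mem_cat.
case: x y x' y' => [[|[|[|[|?]]]] ?] [[|[|[|[|?]]]] ?] //=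
  [[|[|[|[|?]]]] ?] [[|[|[|[|?]]]] ?] //=;
  rewrite /side /= ?mem_rev !mem_cat => + + + _ _;
  by case: (v \in ac); case: (v \in bd); case: (v \in ad); case: (v \in cd);
  intuition.
Qed.

Lemma side_path (x y : K4) : x -- y ->
  path (@sedge G) (corner x) (rcons (side x y) (corner y)).
Proof.
have flip u v s : path (@sedge G) u (rcons s v) -> path (@sedge G) v (rcons (rev s) u).
  move=> h; have := rev_path (@sedge G) u (rcons s v).
  rewrite last_rcons belast_rcons rev_cons => ->.
  by rewrite (eq_path (e' := @sedge G)) // => ? ?; rewrite sedge_sym.
case: fr => /andP[ba bc] _ /andP[pac pbd] /andP[pad pcd] _.
have ab : a -- b by rewrite sedge_sym.
have cb : c -- b by rewrite sedge_sym.
by case: x y => [[|[|[|[|?]]]] ?] [[|[|[|[|?]]]] ?] //= _;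
  rewrite /side /corner /= ?ba ?bc ?ab ?cb //; apply: flip.
Qed.

Lemma K4_degree (x : K4) : 3 <= degree x.
Proof.
rewrite /degree /= (_ : [set y | _] = [set~ x]) ?cardsC1 ?card_ord //.
by apply/setP => y; rewrite !inE eq_sym.
Qed.

Lemma bent_K4_with_skeleton (S : sgraph) (g : S -> K4) : injective g ->
  (forall i j, i -- j = (g i != g j) && (side (g i) (g j) == [::])) ->
  (forall x y, x != y -> side x y = [::] -> exists i, g i = x) ->
  (forall i : S, exists j, i -- j) -> contains_K4_with_skeleton S G.
Proof.
move=> g_inj gE g_onto S_nbr; exists (@subdivided K4 G corner side side_rev side_path).
split.
- exact: (@subdivided_subdivision K4 G corner side corner_inj side_rev side_uniq
            side_disj side_path).
- exact: (@skeleton_iso K4 G corner side corner_inj side_rev side_uniq side_disj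
            side_path K4_degree S g g_inj).
exact: subdivided_subgraph.
Qed.

End BentSubdivision.

(** The definition is symmetric in a and c; this leaves three cases for the two
    unconstrained paths. *)
Lemma bent_swap (G : sgraph) (a b c d : G) ac bd ad cd :
  bent_K4 (@sedge G) a b c d ac bd ad cd -> bent_K4 (@sedge G) c b a d (rev ac) bd cd ad.
Proof.
case=> /andP[ba bc] /andP[ac0 bd0] /andP[pac pbd] /andP[pad pcd] u.
split; rewrite ?ba ?bc ?bd0 ?pcd ?pbd ?rev_nil ?ac0 ?andbT //.
  have := rev_path (@sedge G) a (rcons ac c).
  rewrite last_rcons belast_rcons rev_cons => ->.
  by rewrite (eq_path (e' := @sedge G)) // => ? ?; rewrite sedge_sym.
move: u; congr (is_true _); apply: perm_uniq.
apply: perm_cat.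
  rewrite -[[:: c; b; a; d]]/(rev [:: a; b; c] ++ [:: d]) (perm_cat2r [:: d] [:: a; b; c]).
  by rewrite perm_sym perm_rev.
apply: perm_cat; first by rewrite perm_sym perm_rev.
by rewrite perm_cat2l perm_catC.
Qed.

Lemma has_bent_K4_contains (G : sgraph) : has_bent_K4 (@sedge G) ->
  [\/ contains_K4_with_skeleton (path_graph 3) G,
      contains_K4_with_skeleton (path_graph 4) G
    | contains_K4_with_skeleton (cycle_graph 4) G].
Proof.
case=> a [b [c [d [ac [bd [ad [cd fr]]]]]]].
wlog ad_cd : a c ac ad cd fr / (ad == [::]) ==> (cd == [::]).
  move=> W; case: (boolP ((ad == [::]) ==> (cd == [::]))) => [|h]; first exact: W fr.
  by apply: (W _ _ _ _ _ (bent_swap fr)); move: h; case: (cd == _); case: (ad == _).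
have [_ /andP[/negPf ac0 /negPf bd0] _ _ _] := fr.
case ad0 : (ad == [::]) ad_cd => /= ad_cd; last first.
case cd0: (cd == [::]) => {ad_cd}.
- apply: Or32.
  apply: (@bent_K4_with_skeleton _ _ _ _ _ _ _ _ _ fr (path_graph 4) (fun i : 'I_4 => i)) => //.
  + case=> [[|[|[|[|?]]]] ?] [[|[|[|[|?]]]] ?] //;
    by rewrite /side /= /path_rel /= ?rev_nil ?ac0 ?bd0 ?ad0 ?cd0.
  + by move=> x y _ _; exists x.
  + case=> [[|[|[|[|?]]]] ?] //;
    [exists (inord 1) | exists (inord 0) | exists (inord 1) | exists (inord 2)];
    by rewrite /= /path_rel inordK.
- apply: Or31.
  apply: (@bent_K4_with_skeleton _ _ _ _ _ _ _ _ _ fr (path_graph 3) (widen_ord (leqnSn 3))) => //.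
  + by move=> i j /(congr1 val) /= ij; apply: val_inj.
  + case=> [[|[|[|?]]] ?] [[|[|[|?]]] ?] //;
    by rewrite /side /= /path_rel /= ?rev_nil ?ac0 ?bd0 ?ad0 ?cd0.
  + case=> [[|[|[|[|?]]]] ?] [[|[|[|[|?]]]] ?] //= _; rewrite /side /= => /eqP;
    rewrite ?rev_nil ?ac0 ?bd0 ?ad0 ?cd0 // => _.
    * by exists (inord 0); apply: val_inj; rewrite /= inordK.
    * by exists (inord 1); apply: val_inj; rewrite /= inordK.
    * by exists (inord 1); apply: val_inj; rewrite /= inordK.
    * by exists (inord 2); apply: val_inj; rewrite /= inordK.
  + case=> [[|[|[|?]]] ?] //; [exists (inord 1) | exists (inord 0) | exists (inord 1)];
    by rewrite /= /path_rel inordK.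
- apply: Or33.
  apply: (@bent_K4_with_skeleton _ _ _ _ _ _ _ _ _ fr (cycle_graph 4) (fun i : 'I_4 => i)) => //.
  + case=> [[|[|[|[|?]]]] ?] [[|[|[|[|?]]]] ?] //;
    by rewrite /side /= /cycle_rel /= ?rev_nil ?ac0 ?bd0 ?ad0 ?ad_cd.
  + by move=> x y _ _; exists x.
  + case=> [[|[|[|[|?]]]] ?] //;
    [exists (inord 1) | exists (inord 0) | exists (inord 1) | exists (inord 2)];
    by rewrite /= /cycle_rel -(inj_eq val_inj) /= !inordK.
Qed.

(** * A structured language compiled to the machine *)

(** [When x c] runs [c] if register [x] is nonzero. [For i c] runs [c] as many times
    as register [rN] says, with register [i] counting down to 1; all loops thus
    have the same length, which makes the running time a matter of syntax. *)
Inductive cmd :=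
| Op of instr
| Seq of cmd & cmd
| When of nat & cmd
| For of nat & cmd.

Definition state := ((nat -> nat) * (nat -> nat))%type.

(** The number of iterations of all loops, a register that stays 0, which turns an
    addition into a copy, and a scratch register for the loop counters. *)
Definition rN := 1.
Definition rZero := 2.
Definition rTmp := 3.

Definition run_op (a : instr) (s : state) : state :=
  let: Config _ r m := exec a (Config 0 s.1 s.2) in (r, m).

(** What the compiled loop does after its body: as subtraction takes
    registers only and all jumps are conditional, the scratch register is set to 1
    to decrement the counter, then to 0 to jump back. *)
Definition tick (i : nat) (s : state) : state :=
  run_op (Const rTmp 0) (run_op (Defs.Sub i i rTmp) (run_op (Const rTmp 1) s)).

Arguments run_op : simpl never.
Arguments tick : simpl never.

Fixpoint run (c : cmd) (s : state) : state :=
  match c with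
  | Op a => run_op a s
  | Seq c d => run d (run c s)
  | When x c => if s.1 x == 0 then s else run c s
  | For i c => let s' := run_op (Add i rN rZero) s in
               iter (s'.1 i) (fun u => tick i (run c u)) s'
  end.

Lemma run_For i c s : run (For i c) s =
  iter ((run_op (Add i rN rZero) s).1 i) (fun u => tick i (run c u)) (run_op (Add i rN rZero) s).
Proof. by []. Qed.

Fixpoint code_size (c : cmd) : nat :=
  match c with
  | Op _ => 1
  | Seq c d => code_size c + code_size d
  | When _ c => (code_size c).+1
  | For _ c => code_size c + 6
  end.

(** Jumps are absolute, hence the address [off] of the code. *)
Fixpoint compile (off : nat) (c : cmd) : program :=
  match c with
  | Op a => [:: a]
  | Seq c d => compile off c ++ compile (off + code_size c) d
  | When x c => JumpZero x (off + (code_size c).+1) :: compile off.+1 c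
  | For i c => [:: Add i rN rZero, JumpZero i (off + (code_size c + 6)) & compile off.+2 c
      ++ [:: Const rTmp 1; Defs.Sub i i rTmp; Const rTmp 0; JumpZero rTmp off.+1]]
  end.

Definition written (a : instr) : seq nat :=
  match a with
  | Const x _ | Add x _ _ | Defs.Sub x _ _ | Read x _ => [:: x]
  | _ => [::]
  end.

Definition is_jump (a : instr) := if a is JumpZero _ _ then true else false.
Definition is_write (a : instr) := if a is Write _ _ then true else false.

Fixpoint writes (c : cmd) : seq nat :=
  match c with
  | Op a => written a
  | Seq c d => writes c ++ writes d
  | When _ c => writes c
  | For i c => i :: rTmp :: writes c
  end.

Fixpoint stores (c : cmd) : bool :=
  match c with
  | Op a => is_write a
  | Seq c d => stores c || stores d
  | When _ c | For _ c => stores c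
  end.

Fixpoint wf (c : cmd) : bool :=
  match c with
  | Op a => ~~ is_jump a
  | Seq c d => wf c && wf d
  | When _ c => wf c
  | For i c => [&& wf c, i \notin writes c & i != rTmp]
  end.

(** A command takes at most [weight c * (n + 1) ^ depth c] steps, where [n] is the
    length of the loops. The constants absorb the overhead of a loop: two steps
    around it and five for each iteration. *)
Fixpoint weight (c : cmd) : nat :=
  match c with
  | Op _ => 1
  | Seq c d => weight c + weight d
  | When _ c => (weight c).+1
  | For _ c => weight c + 7
  end.

Fixpoint depth (c : cmd) : nat :=
  match c with
  | Op _ => 0
  | Seq c d => maxn (depth c) (depth d)
  | When _ c => depth c
  | For _ c => (depth c).+1
  end.

Lemma run_op_frame a s x : x \notin written a -> (run_op a s).1 x = s.1 x.
Proof.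
by case: s => r m; case: a => [y k|y p q|y p q|y p|p y|y l] /=;
  rewrite /run_op /= ?inE // => /negPf->.
Qed.

Lemma tick_frame i s x : x != i -> x != rTmp -> (tick i s).1 x = s.1 x.
Proof. by move=> xi xT; rewrite /tick !run_op_frame // inE. Qed.

Lemma tick_mem i s : (tick i s).2 = s.2.
Proof. by []. Qed.

Lemma tick_index i s : i != rTmp -> (tick i s).1 i = (s.1 i).-1.
Proof. by move=> /negPf iT; rewrite /tick /run_op /= !iT eqxx subn1. Qed.

Lemma run_frame c s x : x \notin writes c -> (run c s).1 x = s.1 x.
Proof.
elim: c s => [a|c IHc d IHd|y c IH|i c IH] s.
- exact: run_op_frame.
- by rewrite /= mem_cat negb_or => /andP[xc xd]; rewrite IHd ?IHc.
- by move=> xc /=; case: ifP; rewrite ?IH.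
rewrite run_For !inE !negb_or => /and3P[xi xT xc].
have := @run_op_frame (Add i rN rZero) s x; rewrite inE => /(_ xi).
move: (run_op (Add i rN rZero) s) => s' <-; elim: (s'.1 i) => // k IHk.
by rewrite iterS tick_frame // IH.
Qed.

Lemma run_mem c s : ~~ stores c -> (run c s).2 = s.2.
Proof.
elim: c s => [a|c IHc d IHd|y c IH|i c IH] s.
- by case: a.
- by rewrite /= negb_or => /andP[nc nd]; rewrite IHd ?IHc.
- by move=> nc /=; case: ifP; rewrite ?IH.
rewrite run_For => nc; have : (run_op (Add i rN rZero) s).2 = s.2 by [].
move: (run_op (Add i rN rZero) s) => s' <-; elim: (s'.1 i) => // k IHk.
by rewrite iterS tick_mem IH.
Qed.

Definition code_at (P : program) off l :=
  forall k, k < size l -> onth P (off + k) = onth l k.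

Lemma code_at_cat P off l1 l2 :
  code_at P off (l1 ++ l2) -> code_at P off l1 /\ code_at P (off + size l1) l2.
Proof.
move=> h; split=> k hk.
  by rewrite h ?onth_cat ?hk // size_cat ltn_addr.
rewrite -addnA h ?size_cat ?ltn_add2l // onth_cat addKn ltnNge leq_addr //.
Qed.

Lemma code_at_cons P off a l :
  code_at P off (a :: l) -> onth P off = Some a /\ code_at P off.+1 l.
Proof.
move=> h; split; first by have := h 0 isT; rewrite addn0.
by move=> k hk; have := h k.+1 hk; rewrite addnS.
Qed.

Lemma size_compile off c : size (compile off c) = code_size c.
Proof.
elim: c off => [a|c IHc d IHd|y c IH|i c IH] off //=.
- by rewrite size_cat IHc IHd.
- by rewrite IH.
by rewrite size_cat IH /= !addnS.
Qed.

Lemma step_op P off r m a : ~~ is_jump a -> onth P off = Some a ->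
  step P (Config off r m) = Config off.+1 (run_op a (r, m)).1 (run_op a (r, m)).2.
Proof. by rewrite /step /= => + ->; case: a. Qed.

Lemma step_jump P off r m x l : onth P off = Some (JumpZero x l) ->
  step P (Config off r m) = Config (if r x == 0 then l else off.+1) r m.
Proof. by rewrite /step /= => ->. Qed.

Definition conf off (s : state) := Config off s.1 s.2.

Definition reaches P T s s' := exists2 t, t <= T & iter t (step P) s = s'.

Lemma reaches_trans P T1 T2 s1 s2 s3 :
  reaches P T1 s1 s2 -> reaches P T2 s2 s3 -> reaches P (T1 + T2) s1 s3.
Proof.
move=> [t1 h1 <-] [t2 h2 <-]; exists (t2 + t1); first by rewrite addnC leq_add.
by rewrite iterD.
Qed.

Lemma reaches_step P s : reaches P 1 s (step P s).
Proof. by exists 1. Qed.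

Lemma reaches_le P T T' s s' : T <= T' -> reaches P T s s' -> reaches P T' s s'.
Proof. by move=> TT [t h e]; exists t => //; apply: leq_trans TT. Qed.

(** Since [rN] is never written, one bound on the length of the loops serves
    throughout. *)
Lemma compile_correct P c : wf c -> rN \notin writes c -> rZero \notin writes c ->
  forall off s, s.1 rZero = 0 -> code_at P off (compile off c) ->
  reaches P (weight c * (s.1 rN).+1 ^ depth c) (conf off s)
    (conf (off + code_size c) (run c s)).
Proof.
elim: c => [a|c IHc d IHd|x c IH|i c IH].
- move=> /= ja _ _ off s _ /code_at_cons[oa _]; rewrite mul1n expn0 addn1.
  have -> : conf off.+1 (run_op a s) = step P (conf off s).
    by case: s => r m; rewrite /conf (step_op _ _ ja oa).
  exact: reaches_step.
- move=> /= /andP[wc wd]; rewrite !mem_cat !negb_or => /andP[nc nd] /andP[zc zd].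
  move=> off s s0 /code_at_cat[cc]; rewrite size_compile => cd.
  have rc := IHc wc nc zc off s s0 cc.
  have rd := IHd wd nd zd _ (run c s) (etrans (run_frame _ zc) s0) cd.
  rewrite addnA; apply: reaches_le (reaches_trans rc rd).
  rewrite run_frame // mulnDl.
  by apply: leq_add; rewrite leq_mul2l leq_pexp2l ?leq_maxl ?leq_maxr ?orbT.
- move=> /= wc nc zc off s s0 /code_at_cons[oj cc].
  have st := reaches_step P (conf off s); rewrite /conf (step_jump _ _ oj) in st.
  case: ifP st => x0 st.
    by apply: reaches_le st; rewrite muln_gt0 expn_gt0.
  rewrite -addSnnS; apply: reaches_le (reaches_trans st (IH wc nc zc _ s s0 cc)).
  by rewrite mulSn leq_add2r expn_gt0.
rewrite [wf _]/= [writes _]/= [weight _]/= [depth _]/= [code_size _]/= => /and3P[wc ic iT].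
rewrite !inE !negb_or => /and3P[ni _ nc] /and3P[zi _ zc] off s s0.
move=> /code_at_cons[oa /code_at_cons[oj]].
move=> /code_at_cat[cc]; rewrite size_compile.
move=> /code_at_cons[o1 /code_at_cons[o2 /code_at_cons[o3 /code_at_cons[o4 _]]]].
set n := s.1 rN; set X := n.+1 ^ depth c.
have op_reaches a o u : ~~ is_jump a -> onth P o = Some a ->
    reaches P 1 (conf o u) (conf o.+1 (run_op a u)).
  move=> ja oa'; case: u => r m; have := reaches_step P (conf o (r, m)).
  by rewrite {2}/conf (step_op _ _ ja oa').
have loop k u : u.1 i = k -> u.1 rN = n -> u.1 rZero = 0 ->
    reaches P (1 + k * (weight c * X + 5)) (conf off.+1 u)
      (conf (off + (code_size c + 6)) (iter k (fun u => tick i (run c u)) u)).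
  elim: k u => [|k IHk] u ui un uz; have st := reaches_step P (conf off.+1 u);
    rewrite {2}/conf (step_jump _ _ oj) ui /= in st; first by [].
  have sb := IH wc nc zc _ u uz cc; rewrite un in sb.
  have s1 := op_reaches (Const rTmp 1) _ (run c u) isT o1.
  have s2 := op_reaches (Defs.Sub i i rTmp) _ (run_op (Const rTmp 1) (run c u)) isT o2.
  have s3 := op_reaches (Const rTmp 0) _
    (run_op (Defs.Sub i i rTmp) (run_op (Const rTmp 1) (run c u))) isT o3.
  have s4 := reaches_step P (conf (off.+2 + code_size c).+3 (tick i (run c u))).
  rewrite {2}/conf (step_jump _ _ o4) {1}/tick {1}/run_op /= in s4.
  have := IHk (tick i (run c u)).
  rewrite tick_index // run_frame // ui => /(_ erefl).
  rewrite !tick_frame ?run_frame // => /(_ un uz) sk.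
  rewrite iterSr; apply: reaches_le (reaches_trans st (reaches_trans sb
    (reaches_trans s1 (reaches_trans s2 (reaches_trans s3 (reaches_trans s4 sk)))))).
  by rewrite /X mulSn; lia.
have sa := op_reaches (Add i rN rZero) _ s isT oa.
rewrite run_For; set s1 := run_op (Add i rN rZero) s in sa *.
have s1i : s1.1 i = n by rewrite /s1 /run_op /= eqxx s0 addn0.
have s1n : s1.1 rN = n by rewrite /s1 run_op_frame // inE.
have s1z : s1.1 rZero = 0 by rewrite /s1 run_op_frame // inE.
have sl := loop n s1 s1i s1n s1z; rewrite s1i.
apply: reaches_le (reaches_trans sa sl).
have : 0 < X by rewrite expn_gt0.
rewrite expnS -/X; clear; move: (weight c) X => w Y Y0.
nia.
Qed.

(** [I k] is to hold with [k] iterations left, when the counter is [k]. *)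
Lemma For_ind (I : nat -> state -> Prop) i c s n :
  i \notin writes c -> i != rTmp -> s.1 rN = n -> s.1 rZero = 0 ->
  I n (run_op (Add i rN rZero) s) ->
  (forall k u, 0 < k <= n -> u.1 i = k -> I k u -> I k.-1 (tick i (run c u))) ->
  I 0 (run (For i c) s).
Proof.
move=> ic iT sn sz In Istep; rewrite run_For.
set s1 := run_op (Add i rN rZero) s in In *.
have s1i : s1.1 i = n by rewrite /s1 /run_op /= eqxx sn sz addn0.
rewrite s1i.
suff L k : k <= n -> forall u, u.1 i = k -> I k u -> I 0 (iter k (fun u => tick i (run c u)) u).
  exact: L.
elim: k => // k IHk kn u ui Ik; rewrite iterSr; apply: IHk; first exact: ltnW.
  by rewrite tick_index // run_frame // ui.
exact: (Istep k.+1).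
Qed.

(** * The colouring program *)

(** A loop that accumulates a sum and otherwise only changes the registers that it
    uses. *)
Lemma For_sum (F : nat -> nat) (acc i : nat) c (s : state) n :
  i \notin writes c -> i != rTmp -> acc \notin [:: i; rTmp] -> ~~ stores c ->
  s.1 rN = n -> s.1 rZero = 0 ->
  (forall k u, 0 < k <= n -> u.2 = s.2 ->
     (forall x : nat, x \notin writes (For i c) -> u.1 x = s.1 x) -> u.1 i = k ->
     (run c u).1 acc = u.1 acc + F k) ->
  (run (For i c) s).1 acc = s.1 acc + \sum_(1 <= k < n.+1) F k.
Proof.
move=> ic iT; rewrite !inE negb_or => /andP[ai aT] nst sn sz Fstep.
pose I k (u : state) := [/\ u.2 = s.2, forall x, x \notin writes (For i c) -> u.1 x = s.1 x
  & u.1 acc = s.1 acc + \sum_(k.+1 <= j < n.+1) F j].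
suff: I 0 (run (For i c) s) by case.
apply: (For_ind (n := n)) => //.
  split=> // [x|].
    by rewrite !inE !negb_or => /and3P[xi _ _]; rewrite run_op_frame // inE.
  by rewrite run_op_frame ?inE // big_geq ?addn0.
move=> k u kn ui [um ur ua]; split.
- by rewrite tick_mem run_mem.
- move=> x xw; rewrite -ur //; move: xw; rewrite !inE !negb_or => /and3P[xi xT xc].
  by rewrite tick_frame // run_frame.
rewrite tick_frame // (Fstep k u) // ua prednK; last by case/andP: kn.
by rewrite [in RHS]big_ltn; [rewrite -addnA (addnC (F k)) | case/andP: kn].
Qed.

Notation "c ;; d" := (Seq c d) (at level 60, right associativity).

(** The input, for a graph on n vertices numbered from 1, has the adjacency of i
    and j at address (i - 1) n + j. The stamp of i is kept at n^2 + i and its colour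
    at n^2 + n + i, beyond the input, where 0 means that there is none yet;
    [rStamp] and [rColor] hold n^2 and n^2 + n, and [rRow] holds (i - 1) n while
    vertex i is treated. *)
Notation rOne := 4 (only parsing).
Notation rStamp := 5 (only parsing).
Notation rColor := 6 (only parsing).
Notation rThree := 7 (only parsing).
Notation rRound := 8 (only parsing).
Notation rRow := 9 (only parsing).
Notation rVertex := 10 (only parsing).
Notation rNeighbor := 11 (only parsing).
Notation rCount := 12 (only parsing).
Notation rX := 13 (only parsing).
Notation rY := 14 (only parsing).
Notation rF := 15 (only parsing).
Notation rG := 16 (only parsing).
Notation rK := 17 (only parsing).
Notation rStage := 18 (only parsing).
Notation rA := 19 (only parsing).
Notation rH := 20 (only parsing).

Lemma run_Seq c d s : run (c ;; d) s = run d (run c s).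
Proof. by []. Qed.

(** A vertex is present at the start of round t if its stamp is 0 or t, that is at
    most t, since rounds are counted downwards. With truncated subtraction the
    summand [x - (y - t)], for an adjacency bit [x] and a stamp [y], is 1 exactly for
    such a neighbour and 0 otherwise. *)
Definition count_live : cmd :=
  Op (Const rCount 0);;
  For rNeighbor (
    Op (Add rA rRow rNeighbor);; Op (Read rX rA);;
    Op (Add rA rStamp rNeighbor);; Op (Read rY rA);;
    Op (Defs.Sub rY rY rRound);; Op (Defs.Sub rX rX rY);;
    Op (Add rCount rCount rX)).

Definition live_sum n (s : state) row := \sum_(1 <= j < n.+1)
  (s.2 (row + j) - (s.2 (s.1 rStamp + j) - s.1 rRound)).

Lemma count_live_spec s n : s.1 rN = n -> s.1 rZero = 0 ->
  (run count_live s).1 rCount = live_sum n s (s.1 rRow).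
Proof.
move=> sn sz; rewrite /count_live run_Seq.
rewrite (@For_sum (fun j => s.2 (s.1 rRow + j) - (s.2 (s.1 rStamp + j) - s.1 rRound)) _ _ _ _ n) //.
move=> k u kn um ur ui.
by rewrite /= /run_op /= um ui (ur rRow isT) (ur rStamp isT) (ur rRound isT).
Qed.

(** The register [rF] is 0 exactly if the vertex has no stamp and at most 3
    neighbours are present. *)
Definition try_stamp : cmd :=
  Op (Defs.Sub rRow rRow rN);; count_live;;
  Op (Add rA rStamp rVertex);; Op (Read rY rA);;
  Op (Defs.Sub rF rCount rThree);; Op (Add rF rF rY);; Op (Defs.Sub rG rOne rF);;
  When rG (Op (Write rA rRound)).

Lemma try_stamp_spec s n : s.1 rN = n -> s.1 rZero = 0 -> s.1 rOne = 1 -> s.1 rThree = 3 ->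
  let s' := run try_stamp s in
  s'.1 rRow = s.1 rRow - n /\
  forall a, s'.2 a = if [&& a == s.1 rStamp + s.1 rVertex, s.2 a == 0
                          & live_sum n s (s.1 rRow - n) <= 3] then s.1 rRound else s.2 a.
Proof.
move=> sn sz s1 s3; rewrite /try_stamp 2!run_Seq.
set u := run (Op _) s.
have um : u.2 = s.2 by [].
have ur x : x != rRow -> u.1 x = s.1 x by move=> xr; rewrite /u run_op_frame ?inE.
have urow : u.1 rRow = s.1 rRow - n by rewrite /u /run_op /= sn.
have cnt := @count_live_spec u n (etrans (ur rN isT) sn) (etrans (ur rZero isT) sz).
set v := run count_live u in cnt *.
have vm : v.2 = s.2 by rewrite /v run_mem.
have vr x : x \notin rRow :: writes count_live -> v.1 x = s.1 x.
  by rewrite inE negb_or => /andP[xr xc]; rewrite /v run_frame // ur.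
have vrow : v.1 rRow = s.1 rRow - n by rewrite /v run_frame.
have {}cnt : v.1 rCount = live_sum n s (s.1 rRow - n).
  by rewrite cnt /live_sum urow um !ur.
split.
  by rewrite run_frame.
move=> a; rewrite /= /run_op /= vm cnt.
rewrite (vr rOne isT) (vr rThree isT) (vr rStamp isT) (vr rVertex isT) (vr rRound isT) s1 s3.
move: (live_sum _ _ _) => L; set y := s.2 (_ + _).
case: ifP => h /=; case: eqP => //= ->; rewrite -/y.
  by case: ifP => //; lia.
by case: ifP => //; lia.
Qed.

Definition stamp_phase : cmd :=
  For rRound (Op (Add rRow rStamp rZero);; For rVertex try_stamp).

(** With truncated subtraction, the sum of the two differences of [y] and [c] is
    their distance; so the count is 0 exactly if no neighbour has colour [c]. *)
Definition try_color (c : nat) : cmd :=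
  Op (Const rK c);; Op (Const rCount 0);;
  For rNeighbor (
    Op (Add rA rRow rNeighbor);; Op (Read rX rA);;
    Op (Add rA rColor rNeighbor);; Op (Read rY rA);;
    Op (Defs.Sub rF rY rK);; Op (Defs.Sub rH rK rY);; Op (Add rF rF rH);;
    Op (Defs.Sub rX rX rF);; Op (Add rCount rCount rX));;
  Op (Add rA rColor rVertex);; Op (Defs.Sub rG rOne rCount);;
  When rG (Op (Write rA rK)).

Definition color_sum n (s : state) c := \sum_(1 <= j < n.+1)
  (s.2 (s.1 rRow + j) -
    (s.2 (s.1 rColor + j) - c + (c - s.2 (s.1 rColor + j)))).

Lemma try_color_spec s n c : s.1 rN = n -> s.1 rZero = 0 -> s.1 rOne = 1 ->
  forall a, (run (try_color c) s).2 a =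
    if (a == s.1 rColor + s.1 rVertex) && (color_sum n s c == 0) then c else s.2 a.
Proof.
move=> sn sz s1; rewrite /try_color 3!run_Seq.
set u := run (Op (Const rCount 0)) _.
have um : u.2 = s.2 by [].
have ur x : x \notin [:: rK; rCount] -> u.1 x = s.1 x.
  by rewrite !inE negb_or => /andP[xk xc]; rewrite /u !run_op_frame ?inE.
set L := For rNeighbor _; set v := run L u.
have vm : v.2 = s.2 by rewrite /v run_mem.
have cnt : v.1 rCount = color_sum n s c.
  rewrite /v /L (@For_sum (fun j => s.2 (s.1 rRow + j) -
    (s.2 (s.1 rColor + j) - c + (c - s.2 (s.1 rColor + j)))) _ _ _ _ n) //.
  move=> k w kn wm wr wi.
  rewrite /= /run_op /= wm wi (wr rRow isT) (wr rColor isT) (wr rK isT).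
  by rewrite um (ur rRow isT) (ur rColor isT).
have vr x : x \notin [:: rK, rCount & writes L] -> v.1 x = s.1 x.
  rewrite in_cons negb_or => /andP[xk]; rewrite in_cons negb_or => /andP[xc xL].
  by rewrite /v run_frame // ur // !inE negb_or xk.
have vK : v.1 rK = c by rewrite /v run_frame.
move=> a; rewrite /= /run_op /= vm vK cnt.
rewrite (vr rOne isT) (vr rColor isT) (vr rVertex isT) s1.
by case: ifP => h /=; case: eqP => //= ->; case: ifP => //; lia.
Qed.

(** Colours are tried downwards, so that the least free one is written last. A
    vertex is not its own neighbour, so that writing its colour does not disturb
    the later attempts. *)
Definition color_vertex : cmd :=
  try_color 4;; try_color 3;; try_color 2;; try_color 1.

Definition color_if_due : cmd :=
  Op (Defs.Sub rRow rRow rN);;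
  Op (Add rA rStamp rVertex);; Op (Read rY rA);;
  Op (Defs.Sub rF rY rStage);; Op (Defs.Sub rG rStage rY);; Op (Add rF rF rG);;
  Op (Defs.Sub rG rOne rF);;
  When rG color_vertex.

(** The loop counter decreases while the stamps are to be treated in increasing
    order: the stage is n + 1 minus the counter. *)
Definition color_phase : cmd :=
  For rRound (
    Op (Add rStage rN rOne);; Op (Defs.Sub rStage rStage rRound);;
    Op (Add rRow rStamp rZero);; For rVertex color_if_due).

(** The colours replace the beginning of the input; they are shifted down by 1, as
    0 was reserved for uncoloured vertices. *)
Definition output_phase : cmd :=
  For rVertex (
    Op (Defs.Sub rA rVertex rOne);; Op (Add rH rColor rVertex);; Op (Read rX rH);;
    Op (Defs.Sub rX rX rOne);; Op (Write rA rX)).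

Definition main : cmd := stamp_phase;; color_phase;; output_phase;; Op (Add 0 rN rZero).

Definition prologue : program :=
  [:: Read rN rZero; Const rOne 1; Const rThree 3; Defs.Sub rStamp 0 rOne;
      Add rColor rStamp rN].

Definition greedy : program := prologue ++ compile (size prologue) main.

Lemma main_wf : [&& wf main, rN \notin writes main & rZero \notin writes main].
Proof. by []. Qed.

(** * Correctness of the colouring program *)

(** The graph is seen by the program as a relation [e] on the numbers from 1 to [n]. *)
Section Greedy.
Variables (n : nat) (e : rel nat).
Hypothesis e_sym : symmetric e.
Hypothesis e_irr : irreflexive e.

Definition vtx i := 0 < i <= n.
Definition nb_count (A : pred nat) i := \sum_(1 <= j < n.+1) (e i j && A j).

(** The graph is 3-degenerate. *)
Hypothesis sparse : forall A : pred nat, (exists2 i, vtx i & A i) ->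
  exists2 i, vtx i & A i && (nb_count A i <= 3).

Lemma eq_nb_count A B i : {in vtx, A =1 B} -> nb_count A i = nb_count B i.
Proof. by move=> AB; rewrite /nb_count; apply: eq_big_nat => j hj; rewrite AB. Qed.

(** The state of the stamps with [t] rounds left. Vertices without a stamp have
    value 0 and so count among those of smaller stamp, which is right because
    they will receive a smaller one. The third clause bounds the
    number of vertices left, so that none remains after n rounds. *)
Definition stamped t (sg : nat -> nat) :=
  [/\ forall i, vtx i -> sg i = 0 \/ t < sg i <= n,
      forall i, vtx i -> sg i != 0 -> nb_count (fun j => sg j <= sg i) i <= 3
    & \sum_(1 <= j < n.+1) (sg j == 0) <= t].

Definition round t (sg : nat -> nat) i :=
  if (sg i == 0) && (nb_count (fun j => sg j == 0) i <= 3) then t else sg i.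

(** Vertices that leave together count each other among the neighbours present, so
    the bound of 3 covers neighbours with the same stamp as well. *)
Lemma stamped_round t sg : 0 < t <= n -> stamped t sg -> stamped t.-1 (round t sg).
Proof.
move=> tn [range few zeros]; split.
- move=> i vi; rewrite /round; case: ifP => _; first by right; lia.
  by case: (range i vi); [left|right; lia].
- move=> i vi; rewrite {1}/round; case: ifP => [/andP[si ci] _|hi si].
    rewrite (_ : round t sg i = t); last by rewrite /round si ci.
    rewrite (eq_nb_count (B := fun j => sg j == 0)) // => j vj.
    by rewrite /round; case: ifP => [/andP[-> _]|_]; [lia|]; case: (range j vj); lia.
  rewrite (_ : round t sg i = sg i); last by rewrite /round hi.
  rewrite (eq_nb_count (B := fun j => sg j <= sg i)); first exact: few.
  move=> j vj; rewrite /round; case: ifP => // /andP[/eqP-> _].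
  by case: (range i vi); lia.
have le j : (round t sg j == 0) <= (sg j == 0).
  by rewrite /round; case: ifP => // /andP[-> _]; case: eqP.
case: (boolP (has (fun i => sg i == 0) (iota 1 n))) => [/hasP[i0 i0n si0]|/hasPn none].
  have [|i vi /andP[si ci]] := @sparse (fun j => sg j == 0).
    by exists i0 => //; move: i0n; rewrite mem_iota /vtx; lia.
  suff : \sum_(1 <= j < n.+1) (round t sg j == 0) < \sum_(1 <= j < n.+1) (sg j == 0) by lia.
  have ir : i \in index_iota 1 n.+1 by rewrite mem_index_iota ltnS.
  rewrite !(bigD1_seq i) ?iota_uniq //= -addSn leq_add //; last exact: leq_sum.
  by rewrite /round si ci; case: eqP => //; lia.
rewrite big_nat big1 // => j hj; apply/eqP; rewrite eqb0.
have sj : sg j != 0 by apply: none; rewrite mem_iota; lia.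
by rewrite /round (negPf sj).
Qed.

Definition env (s : state) := [/\ s.1 rN = n, s.1 rZero = 0, s.1 rOne = 1, s.1 rThree = 3
  & s.1 rStamp = n * n /\ s.1 rColor = n * n + n].

Definition env_regs := [:: rN; rZero; rOne; rThree; rStamp; rColor].

Lemma env_eq (s s' : state) : (forall x, x \in env_regs -> s'.1 x = s.1 x) ->
  env s -> env s'.
Proof. by move=> h [? ? ? ? [? ?]]; split; try split; rewrite h. Qed.

Lemma env_den c s : all (fun x => x \notin writes c) env_regs -> env s -> env (run c s).
Proof. by move=> /allP h; apply: env_eq => x /h xc; rewrite run_frame. Qed.

Lemma env_tick i s : i \notin rTmp :: env_regs -> env s -> env (tick i s).
Proof.
rewrite inE negb_or => /andP[iT ie]; apply: env_eq => x xe; rewrite tick_frame //.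
  by apply: contraNneq ie => <-.
by apply: contraTneq xe => ->.
Qed.

Definition adj_mem (m : nat -> nat) :=
  forall i j, vtx i -> vtx j -> m (i.-1 * n + j) = e i j.

Lemma row_bound i j : vtx i -> vtx j -> 0 < i.-1 * n + j <= n * n.
Proof.
case: i => // i /andP[_ hi] /andP[j0 jn] /=.
apply/andP; split; first lia.
apply: leq_trans (_ : i.+1 * n <= _); first by rewrite mulSn; lia.
by rewrite leq_mul2r hi orbT.
Qed.

Definition stamp (m : nat -> nat) i := m (n * n + i).
Definition color (m : nat -> nat) i := m (n * n + n + i).

(** Within a round, stamping some vertices does not change which vertices count as
    present; so the vertices are treated as if simultaneously. *)
Lemma round_spec t s : 0 < t <= n -> env s -> s.1 rRow = n * n -> s.1 rRound = t ->
  adj_mem s.2 -> stamped t (stamp s.2) ->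
  forall a, (run (For rVertex try_stamp) s).2 a =
    if n * n < a <= n * n + n then round t (stamp s.2) (a - n * n) else s.2 a.
Proof.
move=> tn es srow st sadj [range few zeros].
pose I k (u : state) := [/\ env u, u.1 rRow = k * n, u.1 rRound = t
  & forall a, u.2 a = if n * n + k < a <= n * n + n
                      then round t (stamp s.2) (a - n * n) else s.2 a].
suff: I 0 (run (For rVertex try_stamp) s) by case=> _ _ _ h a; rewrite h addn0.
have [sN sZ _ _ _] := es.
apply: (For_ind (n := n)) => //.
  split; first exact: (@env_den (Op (Add rVertex rN rZero))).
  - by rewrite run_op_frame.
  - by rewrite run_op_frame.
  by move=> a; case: ifP => //; lia.
move=> k u kn ui [eu urow ut um].
have [uN uZ u1 u3 [uS uC]] := eu.
have [vrow vm] := try_stamp_spec uN uZ u1 u3.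
split.
- by apply: env_tick => //; apply: env_den.
- by rewrite tick_frame // vrow urow -{2}[n]mul1n -mulnBl subn1.
- by rewrite tick_frame // run_frame.
move=> a; rewrite tick_mem vm ut uS ui urow.
have -> : k * n - n = k.-1 * n by rewrite -{2}[n]mul1n -mulnBl subn1.
have vk : vtx k by [].
have -> : live_sum n u (k.-1 * n) = nb_count (fun j => stamp s.2 j == 0) k.
  apply: eq_big_nat => j hj; have vj : vtx j by [].
  have := row_bound vk vj => rb.
  rewrite ut uS !um; case: ifP => [|_]; first lia.
  rewrite sadj // addKn (_ : s.2 (n * n + j) = stamp s.2 j) // /round.
  have := range j vj; move: (nb_count _ j) => c; case: (stamp s.2 j) => [|w] r /=.
    by rewrite eqxx andbT; case: ifP => _; [case: ifP => _|]; rewrite ?subnn ?subn0.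
  by rewrite if_same /= andbF; case: (e k j); lia.
rewrite um; case: (a =P n * n + k) => [->|ak] /=.
  rewrite ltnn /= addKn /round -/(stamp s.2 k).
  by case: ifP => [?|?]; case: ifP => //; lia.
by case: ifP; case: ifP => //; lia.
Qed.
Lemma stamped_ext t sg sg' : {in vtx, sg =1 sg'} -> stamped t sg -> stamped t sg'.
Proof.
move=> E [range few zeros]; split=> [i vi|i vi|].
- by rewrite -E //; apply: range.
- rewrite -E // => si; rewrite -(eq_nb_count (A := fun j => sg j <= sg i)) ?few //.
  by move=> j vj; rewrite E.
by rewrite -(eq_big_nat _ _ (F1 := fun j => (sg j == 0) : nat)) // => j vj; rewrite E.
Qed.

Lemma stamp_phase_spec s : env s -> adj_mem s.2 -> (forall i, vtx i -> stamp s.2 i = 0) ->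
  let s' := run stamp_phase s in [/\ env s', adj_mem s'.2, stamped 0 (stamp s'.2)
    & forall a, n * n + n < a -> s'.2 a = s.2 a].
Proof.
move=> es sadj s0 s'.
pose I k (u : state) := [/\ env u, adj_mem u.2, stamped k (stamp u.2)
  & forall a, n * n + n < a -> u.2 a = s.2 a].
suff: I 0 s' by [].
have [sN sZ _ _ _] := es.
apply: (For_ind (n := n)) => //.
  split=> //.
  split=> [i vi|i vi|]; rewrite ?[stamp _ i]s0 //; first by left.
  rewrite (eq_big_nat _ _ (F2 := fun=> 1)); first by rewrite sum_nat_const_nat muln1 subn1.
  by move=> j vj; rewrite [stamp _ j]s0.
move=> k u kn ui [eu uadj ust um].
rewrite run_Seq; set v := run (Op _) u.
have ev : env v by apply: env_den.
have vrow : v.1 rRow = n * n.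
  by rewrite /v /= /run_op /=; case: eu => _ -> _ _ [-> _]; rewrite addn0.
have vround : v.1 rRound = k by rewrite run_frame.
have wm : forall a, _ := round_spec kn ev vrow vround uadj ust.
rewrite (_ : v.2 = u.2) // in wm.
set w := run (For rVertex try_stamp) v in wm *.
split; rewrite ?tick_mem.
- by apply: env_tick => //; apply: env_den.
- move=> i j vi vj; rewrite wm uadj //; case: ifP => //.
  by have := row_bound vi vj; lia.
- apply: (stamped_ext (sg := round k (stamp u.2))); last exact: stamped_round.
  move=> i vi; rewrite /stamp wm addKn; case: ifP => //.
  by move: (vi : vtx i); rewrite /vtx; lia.
by move=> a ha; rewrite wm um //; case: ifP => //; lia.
Qed.

Definition free_color (kp : nat -> nat) i c :=
  all (fun j => ~~ (e i j && (kp j == c))) (index_iota 1 n.+1).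

Lemma free_colorP kp i c :
  reflect (forall j, vtx j -> e i j -> kp j != c) (free_color kp i c).
Proof.
apply: (iffP allP) => h j vj.
  by move=> eij; have := h j; rewrite mem_index_iota ltnS eij => /(_ vj).
by rewrite negb_and -implybE; apply/implyP/h; rewrite mem_index_iota ltnS in vj.
Qed.

Lemma free_color_ext kp kp' i c : {in vtx, forall j, j != i -> kp j = kp' j} ->
  free_color kp i c = free_color kp' i c.
Proof.
move=> E; apply: eq_in_all => j; rewrite mem_index_iota ltnS => vj.
by case: (j =P i) => [->|/eqP ji]; rewrite ?e_irr // E.
Qed.

(** The colours [kp] during stage [T], when the vertices of stamp [T] above [k] have
    been treated. *)
Definition colored T k (sg kp : nat -> nat) := forall i, vtx i ->
  [/\ kp i <= 4, kp i != 0 -> sg i <= T,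
      (sg i < T) || (sg i == T) && (k < i) -> kp i != 0
    & forall j, vtx j -> e i j -> kp i != 0 -> kp i != kp j].

(** When vertex [i] is coloured, its coloured neighbours have stamps at most its
    own, so there are at most 3 of them; four used colours would need four. *)
Lemma exists_free T k sg kp i : colored T k sg kp -> vtx i -> sg i = T ->
  nb_count (fun j => sg j <= sg i) i <= 3 -> exists2 c, 0 < c <= 4 & free_color kp i c.
Proof.
move=> col vi si few.
have : has (free_color kp i) (index_iota 1 5).
  apply/negPn/negP; rewrite -all_predC => /allP none.
  have one c : c \in index_iota 1 5 -> 1 <= \sum_(1 <= j < n.+1) (e i j && (kp j == c)).
    move=> /none /=; rewrite /free_color -has_predC => /hasP[j jn /=]; rewrite negbK => h.
    by rewrite (bigD1_seq j) ?iota_uniq //= h.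
  have : \sum_(1 <= c < 5) 1 <= \sum_(1 <= c < 5) \sum_(1 <= j < n.+1) (e i j && (kp j == c)).
    by rewrite big_seq [X in _ <= X]big_seq; apply: leq_sum => c /one.
  rewrite exchange_big /= sum_nat_const_nat => four.
  have : 4 <= nb_count (fun j => sg j <= sg i) i; last by rewrite leqNgt ltnS few.
  apply: leq_trans four _; rewrite /nb_count [X in X <= _]big_nat [X in _ <= X]big_nat.
  apply: leq_sum => j vj; have [k4 kT _ _] := col j vj.
  rewrite /index_iota /= !big_cons big_nil si; case: (e i j) => //=.
  case: (kp j) k4 kT => [|[|[|[|[|w]]]]] //= _ /(_ isT) ->; exact: isT.
case/hasP=> c; rewrite mem_index_iota => hc fc; exists c => //.
Qed.

Lemma colored_step T k sg kp kp' : colored T k sg kp -> vtx k ->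
  {in vtx, forall j, j != k -> kp' j = kp j} ->
  (sg k = T -> 0 < kp' k <= 4 /\ free_color kp k (kp' k)) ->
  (sg k != T -> kp' k = kp k) -> colored T k.-1 sg kp'.
Proof.
move=> col vk off onT offT i vi; have [c4 cT cnz cpr] := col i vi.
case: (sg k =P T) => [skT|/eqP skT]; last first.
  have E j : vtx j -> kp' j = kp j.
    by move=> vj; case: (j =P k) => [->|/eqP jk]; [apply: offT | apply: off].
  rewrite E //; split=> // [h|j vj eij ki]; last by rewrite E //; apply: cpr.
  apply: cnz; move: h; case: ltnP => //= _ /andP[/eqP si ki]; rewrite si eqxx /=.
  have : i != k by apply: contraNneq skT => <-; apply/eqP.
  by move: ki; have := vk; rewrite /vtx; lia.
have [k4 /free_colorP kfree] := onT skT.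
case: (i =P k) => [->|/eqP ik].
  split; [lia | by rewrite skT | by move=> _; lia | ].
  move=> j vj ekj _; rewrite (off j) //; first by rewrite eq_sym kfree.
  by apply: contraTneq ekj => ->; rewrite e_irr.
rewrite (off i) //; split=> // [h|j vj eij ki].
  apply: cnz; move: h; case: ltnP => //= _ /andP[/eqP si ki]; rewrite si eqxx /=.
  by move: ki ik; have := vk; rewrite /vtx; lia.
case: (j =P k) => [jk|/eqP jk]; last by rewrite (off j) //; apply: cpr.
by rewrite jk; apply: kfree; rewrite // e_sym -jk.
Qed.

Lemma colored_next T sg kp : colored T 0 sg kp -> colored T.+1 n sg kp.
Proof.
move=> col i vi; have [c4 cT cnz cpr] := col i vi; split=> //.
  by move/cT/leqW.
move=> h; apply: cnz; move: h vi; rewrite /vtx; lia.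
Qed.
Lemma run_When x c s : run (When x c) s = if s.1 x == 0 then s else run c s.
Proof. by []. Qed.

Definition at_vertex i (s : state) :=
  [/\ env s, adj_mem s.2, s.1 rRow = i.-1 * n & s.1 rVertex = i].

(** The sum computed by the program tests whether a colour is free. *)
Lemma color_sum_eq0 i c s : vtx i -> at_vertex i s ->
  (color_sum n s c == 0) = free_color (color s.2) i c.
Proof.
move=> vi [[_ _ _ _ [_ sC]] sadj srow _].
rewrite /color_sum sum_nat_seq_eq0; apply: eq_in_all => j.
rewrite mem_index_iota ltnS => vj; rewrite srow sC sadj // -/(color s.2 j) /=.
by case: (e i j); case: eqP => //=; lia.
Qed.

Lemma try_color_step i c s : vtx i -> at_vertex i s ->
  let s' := run (try_color c) s in
  [/\ at_vertex i s', forall a, a != n * n + n + i -> s'.2 a = s.2 a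
    & color s'.2 i = if free_color (color s.2) i c then c else color s.2 i].
Proof.
move=> vi Hs; have [es sadj srow sI] := Hs.
have [sN sZ s1 _ [_ sC]] := es.
have wm := try_color_spec c sN sZ s1.
have off a : a != n * n + n + i -> (run (try_color c) s).2 a = s.2 a.
  by move=> ai; rewrite wm sC sI (negPf ai).
split=> //.
  split; [exact: env_den | | by rewrite run_frame | by rewrite run_frame].
  move=> j k vj vk; rewrite off ?sadj //.
  by have := row_bound vj vk; case/andP: vi; lia.
by rewrite /color wm sC sI eqxx /= (color_sum_eq0 c vi Hs).
Qed.

Lemma color_off i m m' : (forall a, a != n * n + n + i -> m' a = m a) ->
  {in vtx, forall j, j != i -> color m' j = color m j}.
Proof. by move=> h j vj ji; apply: h; rewrite eqn_add2l. Qed.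

Lemma color_vertex_spec i s : vtx i -> at_vertex i s ->
  let s' := run color_vertex s in
  [/\ at_vertex i s', forall a, a != n * n + n + i -> s'.2 a = s.2 a
    & (exists2 c, 0 < c <= 4 & free_color (color s.2) i c) ->
      0 < color s'.2 i <= 4 /\ free_color (color s.2) i (color s'.2 i)].
Proof.
move=> vi H0.
rewrite /color_vertex (run_Seq (try_color 4)) (run_Seq (try_color 3)) (run_Seq (try_color 2)).
have [H4 o4 c4] := try_color_step 4 vi H0; set s4 := run (try_color 4) s in H4 o4 c4 *.
have [H3 o3 c3] := try_color_step 3 vi H4; set s3 := run (try_color 3) s4 in H3 o3 c3 *.
have [H2 o2 c2] := try_color_step 2 vi H3; set s2 := run (try_color 2) s3 in H2 o2 c2 *.
have [H1 o1 c1] := try_color_step 1 vi H2; set s1 := run (try_color 1) s2 in H1 o1 c1 *.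
have f4 c : free_color (color s4.2) i c = free_color (color s.2) i c.
  exact: free_color_ext (color_off o4).
have f3 c : free_color (color s3.2) i c = free_color (color s.2) i c.
  by rewrite -f4; apply: free_color_ext (color_off o3).
have f2 c : free_color (color s2.2) i c = free_color (color s.2) i c.
  by rewrite -f3; apply: free_color_ext (color_off o2).
clearbody s1 s2 s3 s4; split; [by [] | by move=> a ai; rewrite o1 ?o2 ?o3 ?o4 | ].
rewrite c1 c2 c3 c4 f4 f3 f2 => -[c hc fc].
case: ifP => F1; first by split. case: ifP => F2; first by split.
case: ifP => F3; first by split. case: ifP => F4; first by split.
move: hc fc.
by case: c => [|[|[|[|[|c]]]]] // _; rewrite ?F1 ?F2 ?F3 ?F4.
Qed.

Lemma color_if_due_spec k T s : vtx k -> env s -> adj_mem s.2 -> s.1 rRow = k * n ->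
  s.1 rVertex = k -> s.1 rStage = T ->
  let s' := run color_if_due s in
  [/\ env s', adj_mem s'.2, s'.1 rRow = k.-1 * n
    & [/\ forall a, a != n * n + n + k -> s'.2 a = s.2 a,
          stamp s.2 k != T -> color s'.2 k = color s.2 k
        & stamp s.2 k = T -> (exists2 c, 0 < c <= 4 & free_color (color s.2) k c) ->
            0 < color s'.2 k <= 4 /\ free_color (color s.2) k (color s'.2 k)]].
Proof.
move=> vk es sadj srow sI sT; rewrite /color_if_due !run_Seq.
set u := run (Op (Defs.Sub rG rOne rF)) _.
have um : u.2 = s.2 by [].
have ur x : x \notin [:: rRow; rA; rY; rF; rG] -> u.1 x = s.1 x.
  by rewrite !inE !negb_or => /and5P[x1 x2 x3 x4 x5]; rewrite /u;
    do 7 (rewrite run_frame; last by rewrite /= inE).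
have [sN sZ s1 _ [sS sC]] := es.
have urow : u.1 rRow = k.-1 * n.
  by rewrite /u /= /run_op /= srow sN -{2}[n]mul1n -mulnBl subn1.
have uG : (u.1 rG == 0) = (stamp s.2 k != T).
  rewrite /u /= /run_op /= s1 sS sI sT -/(stamp s.2 k).
  by case: eqP; case: eqP => //; lia.
have Hu : at_vertex k u by split=> //; rewrite ur.
have [Hv off col] := color_vertex_spec vk Hu.
rewrite run_When uG; case: ifP => [sk|/negbFE/eqP sk].
  split; [by case: Hu | by case: Hu | by [] | split=> //].
  by move=> skT; rewrite skT eqxx in sk.
by split; [case: Hv | case: Hv | rewrite run_frame | split=> //; rewrite sk eqxx].
Qed.

Lemma color_stage_spec T sg s : env s -> adj_mem s.2 -> s.1 rRow = n * n -> s.1 rStage = T ->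
  {in vtx, stamp s.2 =1 sg} ->
  (forall i, vtx i -> nb_count (fun j => sg j <= sg i) i <= 3) ->
  colored T n sg (color s.2) ->
  let s' := run (For rVertex color_if_due) s in
  [/\ env s', adj_mem s'.2, {in vtx, stamp s'.2 =1 sg} & colored T 0 sg (color s'.2)].
Proof.
move=> es sadj srow sT ssg few col s'.
pose I k (u : state) := [/\ env u, u.1 rRow = k * n, u.1 rStage = T &
  [/\ adj_mem u.2, {in vtx, stamp u.2 =1 sg} & colored T k sg (color u.2)]].
suff: I 0 s' by case=> eu _ _ [].
have [sN sZ _ _ _] := es.
apply: (For_ind (n := n)) => //.
move=> k u vk ui [eu urow uT [uadj ust ucol]].
have [ev vadj vrow [off offT onT]] := color_if_due_spec vk eu uadj urow ui uT.
split; [by apply: env_tick | by rewrite tick_frame | by rewrite tick_frame // run_frame | ].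
rewrite tick_mem; split=> // [i vi|].
  rewrite -ust // /stamp off //; move: (vi : vtx i) (vk : vtx k); rewrite /vtx.
  by move=> ? ?; rewrite -addnA eqn_add2l; lia.
apply: (colored_step ucol vk).
- exact: color_off.
- rewrite -(ust k vk) => sk; apply: onT => //; apply: (exists_free ucol vk _ (few k vk)).
  by rewrite -(ust k vk).
by rewrite -(ust k vk).
Qed.

Lemma color_phase_spec sg s : env s -> adj_mem s.2 -> {in vtx, stamp s.2 =1 sg} ->
  (forall i, vtx i -> 0 < sg i <= n) ->
  (forall i, vtx i -> nb_count (fun j => sg j <= sg i) i <= 3) ->
  (forall i, vtx i -> color s.2 i = 0) ->
  let s' := run color_phase s in
  [/\ env s', adj_mem s'.2 & forall i, vtx i -> 0 < color s'.2 i <= 4 /\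
    forall j, vtx j -> e i j -> color s'.2 i != color s'.2 j].
Proof.
move=> es sadj ssg range few s0 s'.
pose I k (u : state) := [/\ env u, adj_mem u.2, {in vtx, stamp u.2 =1 sg}
  & colored (n - k).+1 n sg (color u.2)].
suff [es' adj' st' col] : I 0 s'.
  split=> // i vi; have [c4 _ cnz cpr] := col i vi; have ri := range i vi.
  have ci : color s'.2 i != 0 by apply: cnz; rewrite subn0; lia.
  by split=> [|j vj eij]; [lia | apply: cpr].
have [sN sZ _ _ _] := es.
apply: (For_ind (n := n)) => //.
  split=> // i vi; rewrite [color _ i]s0 //; split=> // h.
  by have := range i vi; have := vi; rewrite /vtx; lia.
move=> k u kn ui [eu uadj ust ucol].
rewrite 3!run_Seq; set v := run (Op (Add rRow rStamp rZero)) _.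
have [uN uZ u1 _ [uS _]] := eu.
have ev : env v by do 3 apply: env_den => //.
have vrow : v.1 rRow = n * n by rewrite /v /= /run_op /= uS uZ addn0.
have vT : v.1 rStage = (n - k).+1.
  by rewrite /v /= /run_op /= uN u1 ui; lia.
have [ew wadj wst wcol] := color_stage_spec ev uadj vrow vT ust few ucol.
split; rewrite ?tick_mem //.
rewrite (_ : (n - k.-1).+1 = (n - k).+2); last lia.
exact: colored_next.
Qed.

Lemma output_phase_spec s : env s ->
  let s' := run output_phase s in env s' /\
  forall a, a < n -> s'.2 a = color s.2 a.+1 - 1.
Proof.
move=> es s'.
pose I k (u : state) := env u /\
  forall a, u.2 a = if k <= a < n then color s.2 a.+1 - 1 else s.2 a.
suff [es' h] : I 0 s' by split=> // a an; rewrite h /= an.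
have [sN sZ _ _ _] := es.
apply: (For_ind (n := n)) => //.
  by split=> // a; case: ifP => //; lia.
move=> k u kn ui [eu um].
have [uN uZ u1 _ [uS uC]] := eu; split; first by apply: env_tick => //; apply: env_den.
have uc : u.2 (n * n + n + k) = color s.2 k by rewrite um; case: ifP => //; lia.
move=> a; rewrite tick_mem /= /run_op /= u1 uC ui uc um.
case: eqP => [->|ak]; last by case: ifP; case: ifP => //; lia.
case: ifP => [_|]; last lia.
by congr (color s.2 _ - 1); lia.
Qed.

Definition proper_word (w : seq nat) := [/\ size w = n, forall i, i < n -> nth 0 w i < 4
  & forall i j, i < n -> j < n -> e i.+1 j.+1 -> nth 0 w i != nth 0 w j].

Lemma main_colors s : env s -> adj_mem s.2 -> (forall a, n * n < a -> s.2 a = 0) ->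
  let s' := run main s in proper_word (mkseq s'.2 (s'.1 0)).
Proof.
move=> es sadj s0; rewrite /main !run_Seq.
have [|e1 adj1 [range few zeros] m1] := stamp_phase_spec es sadj.
  by move=> i vi; apply: s0; rewrite -{1}[n * n]addn0 ltn_add2l; case/andP: vi.
set u1 := run stamp_phase s in e1 adj1 range few zeros m1 *.
have nz i : vtx i -> stamp u1.2 i != 0.
  move=> vi; apply/negP => h; move: zeros; rewrite (bigD1_seq i) ?iota_uniq //= ?h //.
  by rewrite mem_index_iota ltnS.
have [e2 adj2 col] : let s' := run color_phase u1 in
    [/\ env s', adj_mem s'.2 & forall i, vtx i -> 0 < color s'.2 i <= 4 /\
    forall j, vtx j -> e i j -> color s'.2 i != color s'.2 j].
  apply: (color_phase_spec (sg := stamp u1.2)) => // i vi.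
  - by case: (range i vi) => // h; have := nz i vi; rewrite h.
  - by apply: few => //; apply: nz.
  rewrite /color m1 ?s0 //; move: (vi); rewrite /vtx; lia.
have [e3 m3] := output_phase_spec e2.
set u3 := run output_phase _ in e3 m3 *.
have -> : (run (Op (Add 0 rN rZero)) u3).1 0 = n.
  by case: e3 => uN uZ _ _ _; rewrite /= /run_op /= uN uZ addn0.
have -> : (run (Op (Add 0 rN rZero)) u3).2 = u3.2 by [].
split=> [|i ni|i j ni nj eij]; first by rewrite size_mkseq.
  by rewrite nth_mkseq // m3 //; have [] := col i.+1 ni; lia.
rewrite !nth_mkseq // !m3 //; have [ci /(_ j.+1 nj eij) cij] := col i.+1 ni.
have [cj _] := col j.+1 nj; lia.
Qed.
End Greedy.

(** * Graphs as inputs of the program *)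

(** The promise on the graph gives 3-degeneracy. *)
Lemma sparse_vertex (G : sgraph) (W : {set G}) x :
  AstarSP G -> ~ subgraph (complete_graph 5) G -> x \in W ->
  exists2 y, y \in W & #|[set z in W | y -- z]| <= 3.
Proof.
case=> noP3 noP4 noC4 noK5 xW.
case: (boolP [exists y in W, #|[set z in W | y -- z]| <= 3]) => [/exists_inP//|].
rewrite negb_exists_in => /forall_inP dense.
have Wdeg y : y \in W -> 3 < #|[set z in W | y -- z]| by move/dense; rewrite -ltnNge.
by case: (bent_K4_or_K5_in Wdeg xW) => // /has_bent_K4_contains[].
Qed.

Lemma nth_allpairs (S T R : Type) (f : S -> T -> R) (s : seq S) (t : seq T) x0 y0 z0 i j :
  i < size s -> j < size t ->
  nth z0 [seq f x y | x <- s, y <- t] (i * size t + j) = f (nth x0 s i) (nth y0 t j).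
Proof.
elim: s i => // x s IH [|i] /= hi hj; rewrite nth_cat size_map.
  by rewrite hj (nth_map y0).
by rewrite mulSn -addnA ltnNge leq_addr /= addKn IH.
Qed.

Section GraphCode.
Variable G : sgraph.
Let n := #|G|.

(** Vertices are numbered from 1, as the loop counters run from n down to 1. *)
Definition index_edge : rel nat := fun i j =>
  match onth (enum G) i.-1, onth (enum G) j.-1 with
  | Some x, Some y => x -- y
  | _, _ => false
  end.

Lemma index_edge_sym : symmetric index_edge.
Proof.
move=> i j; rewrite /index_edge.
by case: onth => [x|]; case: onth => [y|] //; rewrite sedge_sym.
Qed.

Lemma index_edge_irr : irreflexive index_edge.
Proof. by move=> i; rewrite /index_edge; case: onth => [x|] //; rewrite sedge_irr. Qed.

Definition rank (x : G) := index x (enum G).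

Lemma rank_lt x : rank x < n.
Proof. by rewrite /n cardE index_mem mem_enum. Qed.

Lemma onth_lt (T : Type) (x0 : T) s i : i < size s -> onth s i = Some (nth x0 s i).
Proof. by elim: s i => // x s IH [|i] //= /IH. Qed.

Lemma onth_rank x : onth (enum G) (rank x) = Some x.
Proof.
by rewrite (onth_lt x) ?nth_index ?mem_enum // -cardE rank_lt.
Qed.

Lemma index_edgeE x y : index_edge (rank x).+1 (rank y).+1 = x -- y.
Proof. by rewrite /index_edge /= !onth_rank. Qed.

Lemma size_graph_code : size (graph_code G) = (n * n).+1.
Proof. by rewrite /= size_allpairs -cardE. Qed.

Lemma graph_code_adj : adj_mem n index_edge (nth 0 (graph_code G)).
Proof.
move=> i j; case: i => // i hi; case: j => // j hj; rewrite addnS [LHS]/=.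
have x0 : G by move: hi; rewrite /vtx /n cardE; case: (enum G) => //= x *; exact: x.
rewrite /n {1}cardE (nth_allpairs _ x0 x0) -?cardE //.
by rewrite /index_edge /= !(onth_lt x0) // -cardE.
Qed.

Lemma nb_count_card (A : pred nat) x :
  nb_count n index_edge A (rank x).+1 = #|[set y in [set z | A (rank z).+1] | x -- y]|.
Proof.
have -> : #|[set y in [set z | A (rank z).+1] | x -- y]| =
    \sum_(y <- enum G) (x -- y && A (rank y).+1).
  rewrite -sum1_card big_mkcond /= big_enum /=; apply: eq_bigr => y _.
  by rewrite !inE andbC; case: (_ && _).
rewrite /nb_count big_add1 /= (big_nth x) -cardE; apply: eq_big_nat => i hi.
have hi' : i < size (enum G) by rewrite -cardE.
have ri : rank (nth x (enum G) i) = i by rewrite /rank index_uniq ?enum_uniq.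
by rewrite -[in LHS]ri index_edgeE ri.
Qed.

Lemma index_sparse : AstarSP G -> ~ subgraph (complete_graph 5) G ->
  forall A : pred nat, (exists2 i, vtx n i & A i) ->
  exists2 i, vtx n i & A i && (nb_count n index_edge A i <= 3).
Proof.
move=> sp noK5 A [i vi Ai].
have [x ix] : exists x, i = (rank x).+1.
  case: i vi {Ai} => // i hi.
  have x0 : G by move: hi; rewrite /vtx /n cardE; case: (enum G) => //= x *; exact: x.
  by exists (nth x0 (enum G) i); rewrite /rank index_uniq ?enum_uniq // -cardE.
have xW : x \in [set z | A (rank z).+1] by rewrite inE -ix.
have [y yW ny] := sparse_vertex sp noK5 xW.
exists (rank y).+1; first exact: rank_lt.
by move: yW; rewrite inE => -> /=; rewrite nb_count_card.
Qed.

Lemma proper_word_coloring w : proper_word n index_edge w ->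
  exists2 f : G -> 'I_4, proper_coloring f & w = [seq nat_of_ord (f x) | x <- enum G].
Proof.
case=> sw w4 wE; pose f x : 'I_4 := inord (nth 0 w (rank x)).
have fE x : nat_of_ord (f x) = nth 0 w (rank x) by rewrite inordK // w4 // rank_lt.
exists f => [x y xy|].
  by rewrite -val_eqE /= !fE wE ?rank_lt // index_edgeE.
apply: (@eq_from_nth _ 0); first by rewrite size_map -cardE.
move=> i; rewrite sw => hi.
have x0 : G by move: hi; rewrite /n cardE; case: (enum G) => //= x *; exact: x.
by rewrite (nth_map x0) -?cardE // fE /rank index_uniq ?enum_uniq // -cardE.
Qed.

End GraphCode.

Definition setup (s : state) : state :=
  foldl (fun s a => run_op a s) s prologue.

Lemma setup_reaches s : iter 5 (step greedy) (conf 0 s) = conf 5 (setup s).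
Proof. by case: s. Qed.

Lemma greedy_code : code_at greedy 5 (compile 5 main).
Proof.
by move=> k _; rewrite /greedy onth_cat -/(size prologue) ltnNge leq_addr /= addKn.
Qed.

Theorem proposition1p7 :
  colorable_in_poly_time 4
    (fun G : sgraph => AstarSP G /\ ~ subgraph (complete_graph 5) G).
Proof.
exists greedy, (weight main * 2 ^ depth main + 5), (depth main) => G [sp noK5].
set n := #|G|.
pose s0 : state := (reg (initial (graph_code G)), Defs.mem (initial (graph_code G))).
have s1N : (setup s0).1 rN = n by [].
have es : env n (setup s0).
  split=> //; rewrite /setup /= /run_op /= size_allpairs -cardE -/n; split; lia.
have /and3P[wfm nN nZ] := main_wf.
have [t ht tE] := compile_correct wfm nN nZ (erefl : (setup s0).1 rZero = 0) greedy_code.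
exists (t + 5).
  rewrite size_graph_code -/n; rewrite s1N in ht.
(* The input has length n^2 + 1, and n + 1 is at most twice that. *)
  have : (n.+1) ^ depth main <= 2 ^ depth main * (n * n).+1 ^ depth main.
    by rewrite -expnMn leq_exp2r //; nia.
  move: ht; move: (weight main) (depth main) => w d ht h.
  have : w * n.+1 ^ d <= w * (2 ^ d * (n * n).+1 ^ d) by rewrite leq_mul2l h orbT.
  rewrite mulnDl -mulnA; lia.
have -> : iter (t + 5) (step greedy) (initial (graph_code G)) =
    conf (5 + code_size main) (run main (setup s0)).
  by rewrite iterD -tE -setup_reaches.
split; first by rewrite /halted size_cat size_compile.
apply: proper_word_coloring.
apply: (main_colors (@index_edge_sym G) (@index_edge_irr G) (index_sparse sp noK5) es).
  exact: graph_code_adj.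
move=> a ha; apply: nth_default; by rewrite size_graph_code.
Qed.
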